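(* Let $b\ge 2$ be a fixed integer. For every real $\lambda>0$ there is a unique (in distribution, up to root-preserving isomorphism) rooted connected random multigraph $(G(\lambda),o)$ whose root has finite expected degree and whose distribution is invariant under the operation $(\ast)$ with parameter $\lambda$ described in the context.
   Context: A multigraph is a graph in which there may be several parallel edges between the same pair of distinct vertices (no loops). Rooted random multigraphs are considered up to root-preserving isomorphism; ''invariant under $(\ast)$'' means that applying $(\ast)$ to $(G(\lambda),o)$ yields a rooted random multigraph with the same distribution as $(G(\lambda),o)$. $\mathrm{Po}(\mu)$ denotes the Poisson distribution with mean $\mu$. Operation $(\ast)$ with parameter $\lambda$, applied to a rooted multigraph $(G,o)$: (1) Replace each vertex $v$ of $G$ (including the root $o$) by $b$ vertices $v_0,\dots,v_{b-1}$, and for each unordered pair $i\neq j$ join $v_i$ to $v_j$ by a random number of parallel edges with distribution $\mathrm{Po}(\lambda/b)$. (2) Replace each edge $uv$ of $G$ (each of the parallel edges separately) by one of the $b^2$ edges $v_iu_j$, $i,j\in\{0,\dots,b-1\}$, chosen uniformly at random. All the random choices are made independently of each other (and of $G$). (3) Choose the root of the resulting graph to be each of $o_0,\dots,o_{b-1}$ with probability $1/b$ (again independently). (4) If the resulting graph is disconnected, discard all components not containing the root. *)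

(* Defs.v *)
From HB Require Import structures.
From mathcomp Require Import all_boot all_order all_algebra.
From mathcomp Require Import all_classical all_reals all_analysis.

Set Implicit Arguments.
Unset Strict Implicit.
Unset Printing Implicit Defensive.
Import Order.TTheory GRing.Theory Num.Theory.
Local Open Scope classical_set_scope.

(* The vertices form a subset [verts] of the ambient type [V]; [mult u v] is
   the number of parallel edges between [u] and [v]. Neither connectedness nor
   local finiteness is built in. *)
Record rmgraph (V : Type) := RMGraph {
  verts : set V;
  groot : V;
  mult : V -> V -> nat;
  verts_root : verts groot;
  mult_sym : forall u v, mult u v = mult v u;
  mult_loop : forall v, mult v v = 0%N;
  mult_verts : forall u v, (0 < mult u v)%N -> verts u }.

Section Graph.
Context {V : Type}.
Implicit Types g : rmgraph V.

Definition adj g : rel V := fun u v => (0 < mult g u v)%N.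

Definition reachable g (u v : V) : Prop :=
  exists p : seq V, path (adj g) u p /\ last u p = v.

Definition gconnected g : Prop :=
  forall u v, verts g u -> verts g v -> reachable g u v.

Definition comp_verts g : set V := [set v | reachable g (groot g) v].

Definition comp_mult g (u v : V) : nat :=
  if (u \in comp_verts g) && (v \in comp_verts g) then mult g u v else 0%N.

Fact comp_root g : comp_verts g (groot g).
Proof. by exists [::]. Qed.

Fact comp_sym g u v : comp_mult g u v = comp_mult g v u.
Proof. by rewrite /comp_mult andbC mult_sym. Qed.

Fact comp_loop g v : comp_mult g v v = 0%N.
Proof. by rewrite /comp_mult mult_loop; case: ifP. Qed.

Fact comp_in g u v : (0 < comp_mult g u v)%N -> comp_verts g u.
Proof. by rewrite /comp_mult; case: ifP => // /andP[/set_mem]. Qed.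

Definition component g : rmgraph V :=
  RMGraph (comp_root g) (comp_sym g) (comp_loop g) (@comp_in g).

End Graph.

Definition rooted_iso (V W : Type) (g : rmgraph V) (h : rmgraph W) : Prop :=
  exists f : V -> W,
    [/\ set_bij (verts g) (verts h) f,
        f (groot g) = groot h &
        forall u v, verts g u -> verts g v -> mult h (f u) (f v) = mult g u v].

(* One outcome of the random choices made by the operation on a graph with
   vertices in [nat].
   [newedges v i j], used for [i < j] only: number of edges between the copies
     [i] and [j] of [v];
   [attach u v k], used for [u < v] and [k < mult g u v] only: the pair
     [(i, j)] such that the [k]-th edge between [u] and [v] becomes an edge
     between the copy [i] of [u] and the copy [j] of [v];
   [newroot]: the copy of the old root that becomes the new root. *)
Record choices (b : nat) := Choices {
  newedges : nat -> 'I_b -> 'I_b -> nat;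
  attach : nat -> nat -> nat -> 'I_b * 'I_b;
  newroot : 'I_b }.

Section Star.
Context {b : nat}.
Implicit Types (g : rmgraph nat) (c : choices b) (x y : nat * 'I_b).

Definition blowup_verts g : set (nat * 'I_b) := [set x | verts g x.1].

Definition blowup_mult g c x y : nat :=
  let: (u, i) := x in
  let: (v, j) := y in
  if u == v then
    if u \in verts g then
      if (i < j)%N then newedges c u i j
      else if (j < i)%N then newedges c u j i
      else 0%N
    else 0%N
  else if (u < v)%N then
    (\sum_(k < mult g u v) (attach c u v k == (i, j)))%N
  else
    (\sum_(k < mult g v u) (attach c v u k == (j, i)))%N.

Fact blowup_root g c : blowup_verts g (groot g, newroot c).
Proof. exact: verts_root. Qed.

Fact blowup_sym g c x y : blowup_mult g c x y = blowup_mult g c y x.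
Proof.
case: x y => [u i] [v j] /=; rewrite (eq_sym v u).
case: (ssrnat.ltngtP u v) => // ->.
by case: ifP => // _; case: (ssrnat.ltngtP i j).
Qed.

Fact blowup_loop g c x : blowup_mult g c x x = 0%N.
Proof. by case: x => [u i] /=; rewrite eqxx ltnn; case: ifP. Qed.

Fact blowup_in g c x y : (0 < blowup_mult g c x y)%N -> blowup_verts g x.
Proof.
case: x y => [u i] [v j]; rewrite /blowup_verts /=.
case: eqP => [_|_]; first by case: ifP => // /set_mem.
case: (posnP (mult g u v)) => [m0|m1 _]; last exact: mult_verts m1.
by rewrite (mult_sym g v u) m0 !big_ord0; case: ifP.
Qed.

Definition blowup g c : rmgraph (nat * 'I_b) :=
  RMGraph (blowup_root g c) (blowup_sym g c) (blowup_loop g c)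
    (@blowup_in g c).

Definition star g c : rmgraph (nat * 'I_b) := component (blowup g c).

End Star.

(* The product sigma-algebra on rooted multigraphs with vertices in [nat]. *)
Definition rmgraph_cylinders : set (set (rmgraph nat)) :=
  [set A | (exists v, A = [set g | verts g v]) \/
           (exists v, A = [set g | groot g = v]) \/
           (exists u v n, A = [set g | mult g u v = n])].

Definition rmgraph_point : rmgraph nat.
Proof. by exists [set 0%N] 0%N (fun _ _ => 0%N). Defined.

HB.instance Definition _ := gen_eqMixin (rmgraph nat).
HB.instance Definition _ := gen_choiceMixin (rmgraph nat).
HB.instance Definition _ := isPointed.Build (rmgraph nat) rmgraph_point.
HB.instance Definition _ :=
  @isMeasurable.Build (sigma_display rmgraph_cylinders) (rmgraph nat)
    <<s rmgraph_cylinders >> (@sigma_algebra0 _ setT rmgraph_cylinders)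
    (@sigma_algebraC _ rmgraph_cylinders)
    (@sigma_algebra_bigcup _ setT rmgraph_cylinders).

Definition iso_invariant (A : set (rmgraph nat)) : Prop :=
  forall g h, rooted_iso g h -> A g -> A h.

(* Equality of the image laws on the quotient by [rooted_iso], endowed with
   the quotient sigma-algebra. *)
Definition same_law (R : realType) (mu nu : probability (rmgraph nat) R) :=
  forall A, measurable A -> iso_invariant A -> mu A = nu A.

Definition independent d (T : measurableType d) (R : realType)
    (P : probability T R) (I : Type) (F : I -> set (set T)) : Prop :=
  forall (n : nat) (s : 'I_n -> I), injective s ->
  forall A : 'I_n -> set T, (forall k, F (s k) (A k)) ->
    P (\bigcap_(k in [set: 'I_n]) A k) = (\prod_(k < n) P (A k))%E.

Inductive source (b : nat) :=
  | SGraph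
  | SNewEdges of nat & 'I_b & 'I_b
  | SAttach of nat & nat & nat
  | SNewRoot.

Section Operation.
Local Open Scope ring_scope.
Context d (T : measurableType d) (R : realType) (P : probability T R).
Context (b : nat) (lam : R) (mu : probability (rmgraph nat) R).
Context (G : T -> rmgraph nat) (C : T -> choices b).

(* The sigma-algebra generated by one of the random variables. *)
Definition source_events (s : source b) : set (set T) :=
  match s with
  | SGraph => [set G @^-1` A | A in measurable]
  | SNewEdges v i j =>
      [set (fun w => newedges (C w) v i j) @^-1` A | A in [set: set nat]]
  | SAttach u v k =>
      [set (fun w => attach (C w) u v k) @^-1` A | A in [set: set ('I_b * 'I_b)]]
  | SNewRoot => [set (fun w => newroot (C w)) @^-1` A | A in [set: set 'I_b]]
  end.

Definition star_input : Prop :=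
  [/\ (forall s, source_events s `<=` measurable) /\
        independent P source_events,
      forall A, measurable A -> P (G @^-1` A) = mu A,
      forall v i j n, P [set w | newedges (C w) v i j = n] =
        (poisson_pmf (lam / b%:R) n)%:E,
      forall u v k ij, P [set w | attach (C w) u v k = ij] =
        ((b%:R ^+ 2)^-1)%:E &
      forall i, P [set w | newroot (C w) = i] = (b%:R^-1)%:E].

End Operation.

(* [star (G w) (C w)] has its vertices in [nat * 'I_b], so its isomorphism
   class is compared with that of a graph with vertices in [nat]. The joint law
   of [G] and [C] is determined by [star_input], so the choice of the
   probability space is immaterial. *)
Definition star_invariant (R : realType) (b : nat) (lam : R)
    (mu : probability (rmgraph nat) R) : Prop :=
  exists d (T : measurableType d) (P : probability T R)
         (G : T -> rmgraph nat) (C : T -> choices b),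
    star_input P lam mu G C /\
    forall A, measurable A -> iso_invariant A ->
      P [set w | exists2 h, A h & rooted_iso (star (G w) (C w)) h] = mu A.

Definition degree (R : realType) (g : rmgraph nat) (v : nat) : \bar R :=
  (\sum_(0 <= u <oo) (mult g v u)%:R%:E)%E.

Definition expected_root_degree (R : realType)
    (mu : probability (rmgraph nat) R) : \bar R :=
  (\int[mu]_g degree R g (groot g))%E.

Definition star_fixed (R : realType) (b : nat) (lam : R)
    (mu : probability (rmgraph nat) R) : Prop :=
  [/\ \forall g \ae mu, gconnected g,
      (expected_root_degree mu < +oo)%E &
      star_invariant b lam mu].

(* Main.v *)
(* The operation is a Markov chain on isomorphism classes of rooted graphs; its
   one-step law from [g] is [star_law g]. If the root of [g] has degree at most
   [M], then with probability bounded below in terms of [M] the new root is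
   isolated, that is, the chain jumps to the one-vertex graph.

   Uniqueness: the difference of two invariant laws has a Hahn decomposition on
   the sigma-algebra of isomorphism-invariant events. One of its two parts does
   not contain the one-vertex graph, but the chain reaches this graph in one
   step from almost every starting point, so invariance forces both parts to be
   null.

   Existence: by Kac's formula, the expected occupation measure of an excursion
   from the one-vertex graph is invariant. The expected root degree is a
   Lyapunov function: one step turns [d] into [d / b] plus a constant. Hence both
   the expected length of an excursion and the expected sum of the root degrees
   along it are finite. *)

From HB Require Import structures.
Require Import Defs.
From mathcomp Require Import all_boot all_order all_algebra.
From mathcomp Require Import all_classical all_reals all_analysis.
From mathcomp Require Import measurable_realfun.
From mathcomp Require Import ring lra.

Set Implicit Arguments.
Unset Strict Implicit.
Unset Printing Implicit Defensive.
Import Order.TTheory GRing.Theory Num.Theory.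
Import numFieldNormedType.Exports.
Local Open Scope classical_set_scope.
Local Open Scope ring_scope.

(** * Independent sequences of discrete variables *)

(** [star_invariant] leaves the probability space free and prescribes only independence and
    marginals. These determine the joint law of the graph and the choices, so one law [Pc] of the
    choices serves for all spaces, and invariance becomes the integral equation [\int[nu]_g star_law
    Pc g A = nu A].

    Graphs carry labels, whereas laws are compared on label-free events only. The kernel acts on
    these events because relabelling the vertices preserves the law of the draws; the delicate point
    is that [attach] reads each pair of vertices in increasing order of labels.

    The lower bound for the probability of isolating the root decays with its degree, so there is no
    uniform minorization. Uniqueness needs only positivity almost everywhere, which finite expected
    degree provides. Existence needs a quantitative substitute: [eps <= star_law Pc g isolated + eps
    / M * root_degree R g] for every [g], where the last term takes over as soon as the degree
    exceeds [M], and can be absorbed along an excursion once [M] is large compared with the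
    constants of the drift. *)

Definition image_measure d d' (T1 : measurableType d) (T2 : measurableType d')
    (R : realType) (m : {measure set T1 -> \bar R}) (f : T1 -> T2)
    (mf : measurable_fun setT f) : {measure set T2 -> \bar R}.
Proof.
by unshelve eapply (pushforward m f : {measure set T2 -> \bar R}); exact: mf.
Defined.

Section Uniform.
Context {R : realType}.
Notation TR := (measurableTypeR R).

Lemma measurable_unit_itv : measurable (`[0%R, 1%R[%classic : set TR).
Proof. exact: measurable_itv. Qed.

Definition unit_law : set TR -> \bar R :=
  mrestr lebesgue_measure measurable_unit_itv.

HB.instance Definition _ := Measure.on unit_law.

Let unit_lawT : unit_law setT = 1%E.
Proof.
by rewrite /unit_law /mrestr setTI lebesgue_measure_itv/= lte_fin ltr01 oppr0 addr0.
Qed.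

HB.instance Definition _ :=
  @Measure_isProbability.Build _ _ R unit_law unit_lawT.

(** The pushforward by the affine map, divided by [a], agrees with Lebesgue measure on half-open
    intervals, hence on all measurable sets. *)
Lemma lebesgue_measure_affine (a d : R) (B : set TR) : 0 < a -> measurable B ->
  lebesgue_measure ((fun u : TR => (u - d) / a : TR) @^-1` B) =
  (a%:E * lebesgue_measure B)%E.
Proof.
move=> a0 mB.
have mf : measurable_fun [set: TR] (fun u : TR => (u - d) / a : TR).
  by apply: measurable_funM => //; exact: measurable_funB.
pose f u : TR := (u - d) / a.
have a1 : 0 <= a^-1 by rewrite invr_ge0 ltW.
have -> : lebesgue_measure B = mscale (NngNum a1)
    (image_measure lebesgue_measure mf) B.
  apply: lebesgue_measure_unique mB => _ [[x y] _ <-].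
  change (lebesgue_measure `]x, y]%classic = ((a^-1)%:E *
    lebesgue_measure (f @^-1` `]x, y]%classic))%E).
  rewrite (_ : f @^-1` _ = `](x * a + d), (y * a + d)]%classic); last first.
    apply/seteqP; split => u /=; rewrite !in_itv/= ltr_pdivlMr// ler_pdivrMr//;
    by rewrite ltrBrDr lerBlDr.
  rewrite !lebesgue_measure_itv/= !lte_fin ltrD2r ltr_pM2r//.
  case: ifP => _; last by rewrite mule0.
  rewrite -EFinD -EFinM; congr EFin.
  by rewrite opprD addrACA subrr addr0 -mulrBl mulrCA mulVf ?mulr1 ?gt_eqF.
change (lebesgue_measure (f @^-1` B) =
  (a%:E * ((a^-1)%:E * lebesgue_measure (f @^-1` B)))%E).
by rewrite muleA -EFinM mulfV ?gt_eqF// mul1e.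
Qed.


Section Split.
Context (p : nat -> R).
Hypotheses (p_ge0 : forall n, 0 <= p n)
  (p_sum : (\sum_(0 <= n <oo) (p n)%:E = 1)%E).

Definition cumul n : R := \sum_(i < n) p i.

Lemma cumul_le m n : (m <= n)%N -> cumul m <= cumul n.
Proof.
move=> mn; rewrite /cumul -!(big_mkord xpredT p).
by rewrite [leRHS](big_cat_nat (n := m))//= lerDl sumr_ge0.
Qed.

Lemma cumul_cover (u : R) : u < 1 -> exists n, u < cumul n.
Proof.
move=> u1; apply: contrapT => /forallNP h.
have: (\sum_(0 <= n <oo) (p n)%:E <= u%:E)%E.
  apply: lime_le.
    by apply: is_cvg_nneseries => n _ _; rewrite lee_fin.
  apply: nearW => n; rewrite sumEFin lee_fin big_mkord leNgt.
  by apply/negP; exact: h.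
by rewrite p_sum lee_fin leNgt u1.
Qed.

Definition cell n : set R := `[cumul n, cumul n.+1[%classic.

Lemma cell_uniq m n u : cell m u -> cell n u -> m = n.
Proof.
rewrite /cell /= !in_itv/= => /andP[am bm] /andP[an bn].
wlog mn : m n am bm an bn / (m <= n)%N.
  by move=> h; case: (leqP m n) => [|/ltnW] mn; [exact: h|apply/esym/h].
apply/eqP; rewrite eqn_leq mn leqNgt; apply/negP => /cumul_le.
by rewrite leNgt (le_lt_trans an bm).
Qed.

Lemma cell_ex u : 0 <= u < 1 -> exists n, cell n u.
Proof.
move=> /andP[u0 /cumul_cover uc]; case: (ex_minnP uc) => -[|m] hm mmin.
  by move: hm; rewrite /cumul big_ord0 ltNge u0.
exists m; rewrite /cell/= in_itv/= hm andbT leNgt; apply/negP => /mmin.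
by rewrite ltnn.
Qed.

(* If [u] is uniform on [0, 1[, then [letter u] has law [p], and [rescale u] is
   again uniform and independent of [letter u]; iterating gives the sequence. *)
Definition letter (u : R) : nat := xget 0%N [set n | cell n u].
Definition rescale (u : R) : R := (u - cumul (letter u)) / p (letter u).

Lemma letterE n u : cell n u -> letter u = n.
Proof.
by move=> un; rewrite /letter; case: xgetP => [m _ mu|/(_ n)//]; exact: (cell_uniq mu un).
Qed.

Lemma measurable_cell n : measurable (cell n : set TR).
Proof. exact: measurable_itv. Qed.

Lemma measurable_letter n : measurable (letter @^-1` [set n] : set TR).
Proof.
have -> : letter @^-1` [set n] =
    cell n `|` ([set u | n = 0%N] `&` ~` \bigcup_k cell k).
  apply/seteqP; split => u /=.
    rewrite /letter; case: xgetP => [m _ mu <-|h <-]; first by left.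
    by right; split => // -[k _]; exact: h.
  case=> [/letterE//|[-> h]]; rewrite /letter; case: xgetP => // k _ ku.
  by case: h; exists k.
apply: measurableU; first exact: measurable_cell.
apply: measurableI.
  have [->|/eqP n0] := eqVneq n 0%N.
    by rewrite (_ : [set _ | _] = setT)//; apply/seteqP; split.
  by rewrite (_ : [set _ | _] = set0)//; apply/seteqP; split.
by apply: measurableC; apply: bigcupT_measurable => k; exact: measurable_cell.
Qed.

Lemma measurable_affine (a d : R) :
  measurable_fun [set: TR] (fun u : TR => (u - d) / a : TR).
Proof. by apply: measurable_funM => //; exact: measurable_funB. Qed.

Lemma measurable_rescale : measurable_fun [set: TR] (rescale : TR -> TR).
Proof.
move=> _ B mB; rewrite setTI.
have -> : rescale @^-1` B = \bigcup_n (letter @^-1` [set n] `&`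
    (fun u : TR => (u - cumul n) / p n : TR) @^-1` B).
  apply/seteqP; split => [u /= Bu|u [n _ [/= <-]]//].
  by exists (letter u).
apply: bigcupT_measurable => n; apply: measurableI; first exact: measurable_letter.
by rewrite -[X in measurable X]setTI; exact: measurable_affine.
Qed.

(** On the cell of [n], an interval of length [p n], [rescale] is the affine bijection onto [0,
    1[. *)
Lemma unit_law_cell n (B : set TR) : measurable B ->
  unit_law (letter @^-1` [set n] `&` rescale @^-1` B) =
  ((p n)%:E * unit_law B)%E.
Proof.
move=> mB; rewrite /unit_law /mrestr.
have [pn0|pn0] := eqVneq (p n) 0.
  (* The cell of [n] is empty. A point with letter [n] could then only come from the default value
     of [letter], which is taken outside [0, 1[. *)
  rewrite pn0 mul0e (_ : _ `&` _ = set0) ?measure0//.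
  apply/seteqP; split => // u [[/= ln _] u01].
  have [k ku] : exists n, cell n u by apply: cell_ex; move: u01; rewrite in_itv.
  move: (ku); rewrite -(letterE ku) ln /cell/= in_itv/= /cumul big_ord_recr/= pn0 addr0.
  by case: ltgtP.
have {pn0}pn : 0 < p n by rewrite lt_neqAle eq_sym pn0 p_ge0.
rewrite -(lebesgue_measure_affine (cumul n) pn); last first.
  by apply: measurableI => //; exact: measurable_unit_itv.
congr (lebesgue_measure _); apply/seteqP; split => u /=.
  rewrite !in_itv /= => -[[ln Bu] u01].
  have [k ku] := cell_ex u01.
  have ? := letterE ku; subst k; move: Bu; rewrite /rescale ln; split => //.
  move: ku; rewrite ln /cell/= in_itv/= /cumul big_ord_recr/= => /andP[h1 h2].
  by rewrite divr_ge0 ?subr_ge0//= ltr_pdivrMr// mul1r ltrBlDl.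
rewrite !in_itv/= => -[Bu /andP[h1 h2]].
have nu : cell n u.
  move: h1 h2; rewrite /cell/= in_itv/= /cumul big_ord_recr/= pmulr_lge0 ?invr_gt0//
    subr_ge0 => -> /=.
  by rewrite ltr_pdivrMr// mul1r ltrBlDl.
have ln := letterE nu.
rewrite /rescale ln; split => //.
move: nu; rewrite /cell/= in_itv/= => /andP[h3 h4]; apply/andP; split.
  by apply: le_trans h3; rewrite sumr_ge0.
apply: lt_le_trans h4 _; rewrite -lee_fin -p_sum.
apply: le_trans (nneseries_lim_ge n.+1 _) => //; last by move=> i _ _; rewrite lee_fin.
by rewrite sumEFin big_mkord.
Qed.

Lemma unit_law_letter n : unit_law (letter @^-1` [set n]) = (p n)%:E.
Proof.
have := unit_law_cell n (@measurableT _ TR).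
by rewrite preimage_setT setIT probability_setT mule1.
Qed.

Lemma measurable_letters (S : set nat) : measurable (letter @^-1` S : set TR).
Proof.
have -> : letter @^-1` S = \bigcup_(n in S) (letter @^-1` [set n]).
  apply/seteqP; split => [u Su|u [n Sn /= lu]]; first by exists (letter u).
  by rewrite /preimage/= lu.
by apply: bigcup_measurable => n _; exact: measurable_letter.
Qed.

Lemma unit_law_split (S : set nat) (B : set TR) : measurable B ->
  unit_law (letter @^-1` S `&` rescale @^-1` B) =
  (unit_law (letter @^-1` S) * unit_law B)%E.
Proof.
move=> mB.
have mr n : measurable (letter @^-1` [set n] `&` rescale @^-1` B : set TR).
  apply: measurableI; first exact: measurable_letter.
  by rewrite -[X in measurable X]setTI; exact: measurable_rescale.
have lS : letter @^-1` S = \bigcup_(n in S) (letter @^-1` [set n]).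
  apply/seteqP; split => [u Su|u [n Sn /= lu]]; first by exists (letter u).
  by rewrite /preimage/= lu.
have tl C : trivIset S (fun n => letter @^-1` [set n] `&` C).
  by move=> i j _ _ [u [[/= <- _] [/= <- _]]].
rewrite lS setI_bigcupl !measure_bigcup//; last 2 first.
  - by move=> n _; exact: measurable_letter.
  - by have := tl setT; under eq_fun do rewrite setIT.
have uB : unit_law B \is a fin_num by exact: fin_num_measure.
rewrite muleC -(fineK uB) -nneseriesZl; last by move=> n _; exact: measure_ge0.
apply: eq_eseriesr => n _.
rewrite fineK// muleC; apply: etrans (unit_law_cell _ mB) _.
by congr (_ * _)%E; exact/esym/unit_law_letter.
Qed.

End Split.
End Uniform.

Theorem independent_sequence_exists (R : realType) (p : nat -> nat -> R)
    (p_ge0 : forall j n, 0 <= p j n)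
    (p_sum : forall j, (\sum_(0 <= n <oo) (p j n)%:E = 1)%E) :
  exists d (T : measurableType d) (P : probability T R) (Y : nat -> T -> nat),
    [/\ forall j S, measurable (Y j @^-1` S),
        forall j n, P (Y j @^-1` [set n]) = (p j n)%:E &
        forall n (S : nat -> set nat),
          P (\bigcap_(j < n) (Y j @^-1` S j)) =
          (\prod_(j < n) P (Y j @^-1` S j))%E].
Proof.
pose TR := measurableTypeR R.
pose st := fix st n : TR -> TR :=
  if n is m.+1 then fun u => rescale (p m) (st m u) else id.
have mst n : measurable_fun setT (st n).
  elim: n => [|n IH]; first exact: measurable_id.
  exact: (measurableT_comp (measurable_rescale (p_ge0 n)) IH).
pose Y j u := letter (p j) (st j u).
have mY j S : measurable (Y j @^-1` S : set TR).
  rewrite -[X in measurable X]setTI.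
  by apply: (mst j measurableT (letter (p j) @^-1` S)); exact: measurable_letters.
(* Keeping an event [B] on the remaining uniform variable [st n] makes the induction work: the next
   letter and the next remainder are both read from [st n]. *)
have H n (S : nat -> set nat) (B : set TR) : measurable B ->
    unit_law (\bigcap_(j < n) (Y j @^-1` S j) `&` st n @^-1` B) =
    (\prod_(j < n) unit_law (letter (p j) @^-1` S j) * unit_law B)%E.
  elim: n B => [|n IH] B mB.
    by rewrite big_ord0 mul1e bigcap_mkord big_ord0 setTI.
  have -> : \bigcap_(j < n.+1) (Y j @^-1` S j) `&` st n.+1 @^-1` B =
      \bigcap_(j < n) (Y j @^-1` S j) `&`
      st n @^-1` (letter (p n) @^-1` S n `&` rescale (p n) @^-1` B).
    apply/seteqP; split => u /=.
      move=> [h Bu]; split => [j jn|]; first by apply: h => /=; exact: ltnW.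
      by split => //; apply: (h n) => /=.
    move=> [h [Su Bu]]; split => // j /=; rewrite ltnS leq_eqVlt => /orP[/eqP->//|].
    exact: h.
  rewrite IH; last first.
    apply: measurableI; first exact: measurable_letters.
    by rewrite -[X in measurable X]setTI; exact: measurable_rescale.
  by rewrite big_ord_recr/= -muleA unit_law_split.
(* Only the last of the first [j.+1] letters is constrained, so the product reduces to one
   factor. *)
have HY j S : unit_law (Y j @^-1` S) = unit_law (letter (p j) @^-1` S).
  have := H j.+1 (fun i => if i == j then S else setT) setT measurableT.
  rewrite preimage_setT setIT probability_setT mule1 big_ord_recr/= eqxx big1 => [|i _].
    rewrite mul1e => <-; congr (unit_law _).
    apply/seteqP; split => u /= => [Su i /=|/(_ j) /=]; last by rewrite eqxx; apply.
    by rewrite ltnS; case: eqP => [->|].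
  by rewrite ltn_eqF//= preimage_setT probability_setT.
exists _, TR, unit_law, Y; split => [//|j n|n S].
  by apply: etrans (HY _ _) _; exact: unit_law_letter.
have := H n S setT measurableT.
rewrite preimage_setT setIT probability_setT mule1 => HS.
apply: etrans HS _.
by apply: eq_bigr => j _; exact/esym/HY.
Qed.

(** * The law of the random choices *)

HB.instance Definition _ (b : nat) := gen_eqMixin (source b).
HB.instance Definition _ (b : nat) := gen_choiceMixin (source b).
HB.instance Definition _ (b : nat) := gen_eqMixin (choices b).
HB.instance Definition _ (b : nat) := gen_choiceMixin (choices b).
HB.instance Definition _ (b : nat) := isPointed.Build (choices b.+1)
  (Choices (fun _ _ _ => 0%N) (fun _ _ _ => (ord0, ord0)) ord0).

(* The singleton [[set setT]] at [SGraph] makes the draws of a [choices] an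
   independent family over the whole type [source]. *)
Definition choice_events (b : nat) (s : source b) : set (set (choices b)) :=
  match s with
  | SGraph => [set setT]
  | SNewEdges v i j => [set (fun c => newedges c v i j) @^-1` A | A in setT]
  | SAttach u v k => [set (fun c => attach c u v k) @^-1` A | A in setT]
  | SNewRoot => [set @newroot b @^-1` A | A in setT]
  end.

Lemma choice_eventsT b (s : source b) : choice_events s setT.
Proof. by case: s => [|v i j|u v k|] //=; exists setT. Qed.

Lemma choice_eventsI b (s : source b) : setI_closed (choice_events s).
Proof.
case: s => [|v i j|u v k|] A B /=; first by move=> -> ->; rewrite setIT.
all: by move=> [A' _ <-] [B' _ <-]; exists (A' `&` B').
Qed.

HB.instance Definition _ (b : nat) :=
  @isMeasurable.Build
    (sigma_display (\bigcup_s (@choice_events b.+1 s))) (choices b.+1)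
    <<s \bigcup_s (@choice_events b.+1 s) >>
    (@sigma_algebra0 _ setT _) (@sigma_algebraC _ _)
    (@sigma_algebra_bigcup _ setT _).

Lemma measurable_choice_events b (s : source b.+1) :
  choice_events s `<=` measurable.
Proof. by move=> A sA; apply: sub_sigma_algebra; exists s. Qed.

Lemma measurable_choices_fun b d (T : measurableType d)
    (C : T -> choices b.+1) :
  (forall s A, choice_events s A -> measurable (C @^-1` A)) ->
  measurable_fun setT C.
Proof.
move=> h; apply: (measurability (\bigcup_s (@choice_events b.+1 s))) => //.
by move=> _ [B [s _ sB] <-]; rewrite setTI; exact: h sB.
Qed.

(** Independence for duplicate-free lists of draws. The injection [phi] is for renamed draws: the
    event indexed by [s] may concern the draw [phi s]. *)
Lemma independent_seq d (T : measurableType d) (R : realType)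
    (P : probability T R) (I J : eqType) (F : J -> set (set T))
    (phi : I -> J) (l : seq I) (A : I -> set T) :
  independent P F -> injective phi -> uniq l ->
  (forall s, F (phi s) (A s)) ->
  P (\bigcap_(s in [set` l]) A s) = (\prod_(s <- l) P (A s))%E.
Proof.
move=> indF phi_inj ul FA.
have -> : \bigcap_(s in [set` l]) A s =
    \bigcap_(k in [set: 'I_(size l)]) A (tnth (in_tuple l) k).
  apply/seteqP; split => w h => [k _|s /= sl]; first by apply: h; exact: mem_tnth.
  by have /tnthP[k ->] : s \in in_tuple l by []; exact: h.
rewrite (indF _ (fun k => phi (tnth (in_tuple l) k))) => [|i j /phi_inj|k].
- by rewrite [RHS]big_tnth.
- by move/(tuple_uniqP (in_tuple l)): ul; apply.
- exact: FA.
Qed.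

Lemma discrete_law_eq d d' (T : measurableType d) (T' : measurableType d')
    (R : realType) (P : probability T R) (P' : probability T' R)
    (I : countType) (X : T -> I) (X' : T' -> I) (S : set I) :
  (forall i, measurable (X @^-1` [set i])) ->
  (forall i, measurable (X' @^-1` [set i])) ->
  (forall i, P (X @^-1` [set i]) = P' (X' @^-1` [set i])) ->
  P (X @^-1` S) = P' (X' @^-1` S).
Proof.
move=> mX mX' XX'.
(* Several codes may decode to the same value; the test [pickle i == n] keeps one of them, so that
   the pieces are disjoint. *)
have decomp U (Y : U -> I) : Y @^-1` S =
    \bigcup_n (if unpickle n is Some i then
      if `[< S i >] && (pickle i == n) then Y @^-1` [set i] else set0 else set0).
  apply/seteqP; split => w.
    move=> /= Sw; exists (pickle (Y w)) => //; rewrite pickleK eqxx andbT.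
    by move/asboolP: Sw => ->.
  move=> [n _]; case: unpickle => //= i; case: ifPn => // /andP[/asboolP Si _] /=.
  by move=> ->.
have triv U (Y : U -> I) : trivIset setT (fun n => if unpickle n is Some i then
      if `[< S i >] && (pickle i == n) then Y @^-1` [set i] else set0 else set0).
  move=> m n _ _ [w []].
  case: unpickle => //= i; case: ifPn => // /andP[_ /eqP <-] /= <-.
  by case: unpickle => //= j; case: ifPn => // /andP[_ /eqP <-] /= ->.
rewrite (decomp _ X) (decomp _ X') !measure_bigcup//; last 2 first.
- by move=> n _; case: unpickle => // i; case: ifP.
- by move=> n _; case: unpickle => // i; case: ifP.
apply: eq_eseriesr => n _.
case: unpickle => [i|]; last by rewrite !measure0.
by case: ifP => _; [exact: XX'|rewrite !measure0].
Qed.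

(** * Independence and marginals determine the law of the choices *)

Section ChoicesLaw.
Context {R : realType} {b : nat}.
Variable lam : R.
Notation Ch := (choices b.+1).

Definition choices_marginals d (T : measurableType d) (P : probability T R)
    (C : T -> Ch) : Prop :=
  [/\ forall v i j n, P [set w | newedges (C w) v i j = n] =
        (poisson_pmf (lam / b.+1%:R) n)%:E,
      forall u v k ij, P [set w | attach (C w) u v k = ij] =
        ((b.+1%:R ^+ 2)^-1)%:E &
      forall i, P [set w | newroot (C w) = i] = (b.+1%:R^-1)%:E].

Lemma choices_marginals_eq d d' (T : measurableType d) (T' : measurableType d')
    (P : probability T R) (P' : probability T' R) (C : T -> Ch) (C' : T' -> Ch)
    s A :
  measurable_fun setT C -> measurable_fun setT C' ->
  choices_marginals P C -> choices_marginals P' C' ->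
  choice_events s A -> P (C @^-1` A) = P' (C' @^-1` A).
Proof.
move=> mC mC' [h1 h2 h3] [h1' h2' h3'] sA.
have mm dU (U : measurableType dU) (D : U -> Ch) B : measurable_fun setT D ->
    choice_events s B -> measurable (D @^-1` B).
  by move=> mD sB; rewrite -[X in measurable X]setTI; apply: mD => //;
    exact: measurable_choice_events sB.
case: s sA mm => [|v i j|u v k|] /=.
- by move=> -> _; rewrite !preimage_setT !probability_setT.
- move=> [S _ <-] mm.
  apply: (discrete_law_eq S (X := fun w => newedges (C w) v i j)
     (X' := fun w => newedges (C' w) v i j)) => n.
  + by apply: (mm _ _ C ((fun c => newedges c v i j) @^-1` [set n])) => //; exists [set n].
  + by apply: (mm _ _ C' ((fun c => newedges c v i j) @^-1` [set n])) => //; exists [set n].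
  + by rewrite [LHS]h1 [RHS]h1'.
- move=> [S _ <-] mm.
  apply: (discrete_law_eq S (X := fun w => attach (C w) u v k)
     (X' := fun w => attach (C' w) u v k)) => n.
  + by apply: (mm _ _ C ((fun c => attach c u v k) @^-1` [set n])) => //; exists [set n].
  + by apply: (mm _ _ C' ((fun c => attach c u v k) @^-1` [set n])) => //; exists [set n].
  + by rewrite [LHS]h2 [RHS]h2'.
- move=> [S _ <-] mm.
  apply: (discrete_law_eq S (X := fun w => newroot (C w))
     (X' := fun w => newroot (C' w))) => n.
  + by apply: (mm _ _ C ((@newroot b.+1) @^-1` [set n])) => //; exists [set n].
  + by apply: (mm _ _ C' ((@newroot b.+1) @^-1` [set n])) => //; exists [set n].
  + by rewrite [LHS]h3 [RHS]h3'.
Qed.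

Definition choice_rectangles : set (set Ch) :=
  [set B | exists (A : source b.+1 -> set Ch) (l : seq (source b.+1)),
    (forall s, choice_events s (A s)) /\ B = \bigcap_(s in [set` l]) A s].

Lemma choice_rectanglesI : setI_closed choice_rectangles.
Proof.
move=> _ _ [A [l [hA ->]]] [A' [l' [hA' ->]]].
exists (fun s => (if s \in l then A s else setT) `&`
                 (if s \in l' then A' s else setT)), (l ++ l').
split => [s|].
  by apply: choice_eventsI; case: ifP => _ //; exact: choice_eventsT.
apply/seteqP; split => w.
  move=> [h h'] s /=; rewrite mem_cat => _; split.
    by case: ifP => // sl; exact: h.
  by case: ifP => // sl; exact: h'.
move=> h; split => s /= sl.
  by have /(_ _)[|+ _] := h s; rewrite /= ?mem_cat ?sl//.
by have /(_ _)[|_ +] := h s; rewrite /= ?mem_cat ?sl ?orbT//.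
Qed.

Lemma choices_sigmaE :
  @measurable _ Ch = <<s choice_rectangles >>.
Proof.
rewrite eqEsubset; split.
  apply: smallest_sub; first exact: smallest_sigma_algebra.
  move=> A [s _ sA]; apply: sub_sigma_algebra.
  exists (fun t => if t == s then A else setT), [:: s]; split.
    by move=> t; case: eqP => [->//|_]; exact: choice_eventsT.
  apply/seteqP; split => w.
    by move=> Aw t /=; rewrite inE => /eqP ->; rewrite eqxx.
  by move=> /(_ s); rewrite eqxx; apply; rewrite /= inE.
apply: smallest_sub; first exact: sigma_algebra_measurable.
move=> _ [A [l [hA ->]]].
rewrite bigcap_seq; apply: bigsetI_measurable => s _.
exact: measurable_choice_events (hA s).
Qed.

Variable Pc : probability Ch R.

(** Both sides are finite measures in [B] that agree on the rectangles, a generating class stable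
    under intersection. The event [D] lets one statement serve twice: with the full event for
    renamed choices, and with an event of the random graph for the joint law. *)
Lemma choices_law_unique d (T : measurableType d) (P : probability T R)
    (D : set T) (C : T -> Ch) :
  measurable D -> measurable_fun setT C ->
  (forall (A : source b.+1 -> set Ch) (l : seq (source b.+1)),
     (forall s, choice_events s (A s)) -> uniq l ->
     P (D `&` \bigcap_(s in [set` l]) (C @^-1` (A s))) =
     (P D * \prod_(s <- l) Pc (A s))%E) ->
  independent Pc (@choice_events b.+1) ->
  forall B, measurable B -> P (D `&` C @^-1` B) = (P D * Pc B)%E.
Proof.
move=> mD mC h ind B mB.
have PDfin : P D \is a fin_num by exact: fin_num_measure.
have PD0 : 0 <= fine (P D) by rewrite fine_ge0.
pose m1 : {measure set Ch -> \bar R} := image_measure (mrestr P mD) mC.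
pose m2 : {measure set Ch -> \bar R} := mscale (NngNum PD0) Pc.
have m1E X : m1 X = P (D `&` C @^-1` X) by rewrite setIC.
have m2E X : m2 X = (P D * Pc X)%E by rewrite -[in RHS](fineK PDfin).
rewrite -m1E -m2E.
apply: (measure_unique choice_rectangles (fun _ => setT)) => //.
- exact: choices_sigmaE.
- exact: choice_rectanglesI.
- move=> _; exists (fun _ => setT), [::]; split; first exact: choice_eventsT.
  by rewrite bigcap_seq big_nil.
- by rewrite bigcup_const//; exists 0%N.
- move=> _ [A [l [hA ->]]]; rewrite m1E m2E.
  have <- : \bigcap_(s in [set` undup l]) A s = \bigcap_(s in [set` l]) A s.
    by apply/seteqP; split => w hw s /= sl; apply: hw; rewrite /= ?mem_undup// -mem_undup.
  rewrite preimage_bigcap h ?undup_uniq//.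
  by rewrite (independent_seq (phi := id) ind)// undup_uniq.
- by move=> k; rewrite m1E; apply: le_lt_trans (probability_le1 _ _) (ltry _);
   rewrite preimage_setT setIT.
Qed.

End ChoicesLaw.

(** The chosen indices are embedded in an initial segment, where the other positions receive the
    full event and contribute factors 1. *)
Lemma independent_initial d (T : measurableType d) (R : realType)
    (P : probability T R) (Y : nat -> T -> nat) :
  (forall n (S : nat -> set nat),
     P (\bigcap_(j < n) (Y j @^-1` S j)) =
     (\prod_(j < n) P (Y j @^-1` S j))%E) ->
  forall n (j : 'I_n -> nat) (S : 'I_n -> set nat), injective j ->
  P (\bigcap_(k in [set: 'I_n]) (Y (j k) @^-1` S k)) =
  (\prod_(k < n) P (Y (j k) @^-1` S k))%E.
Proof.
move=> h n j S j_inj.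
pose S' m := if [pick k | j k == m] is Some k then S k else setT.
have S'j k : S' (j k) = S k.
  rewrite /S'; case: pickP => [k' /eqP/j_inj -> //|/(_ k)]; by rewrite eqxx.
have S'N m : m \notin codom j -> S' m = setT.
  move=> mj; rewrite /S'; case: pickP => // k /eqP jm.
  by rewrite -jm codom_f in mj.
pose N := (\max_k j k).+1.
have jN k : (j k < N)%N by rewrite ltnS; exact: leq_bigmax.
have -> : \bigcap_(k in [set: 'I_n]) (Y (j k) @^-1` S k) =
    \bigcap_(m < N) (Y m @^-1` S' m).
  apply/seteqP; split => w hw.
    move=> m /= _; case: (boolP (m \in codom j)) => [/codomP[k ->]|/S'N -> //].
    by rewrite S'j; exact: hw.
  by move=> k _; rewrite -S'j; exact: hw (jN k).
rewrite h -(big_mkord xpredT (fun m => P (Y m @^-1` S' m))).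
rewrite (bigID (mem (codom j)))/= [X in (_ * X)%E]big1 ?mule1 => [|m mj]; last first.
  by rewrite S'N// preimage_setT probability_setT.
rewrite -big_filter (perm_big (codom j)).
  rewrite /codom /image_mem big_map big_enum/=.
  by apply: eq_bigr => k _; rewrite S'j.
apply: uniq_perm; first by rewrite filter_uniq// iota_uniq.
  by rewrite /codom /image_mem map_inj_uniq// enum_uniq.
move=> m; rewrite mem_filter/= andb_idr//.
by move=> /codomP[k ->]; rewrite mem_index_iota/= jN.
Qed.

Definition uniform_pmf (R : realType) (N n : nat) : R :=
  if (n < N)%N then N%:R^-1 else 0.

Lemma uniform_pmf_ge0 (R : realType) N n : 0 <= uniform_pmf R N n.
Proof. by rewrite /uniform_pmf; case: ifP => // _; rewrite invr_ge0. Qed.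

Lemma uniform_pmf_sum (R : realType) N : (0 < N)%N ->
  (\sum_(0 <= n <oo) (uniform_pmf R N n)%:E = 1)%E.
Proof.
move=> N0; rewrite (nneseries_split 0 N)//; last first.
  by move=> k _; rewrite lee_fin uniform_pmf_ge0.
rewrite add0n eseries0 => [|k Nk _]; last by rewrite /uniform_pmf ltnNge Nk.
rewrite adde0 sumEFin big_mkord; congr EFin.
rewrite (eq_bigr (fun=> N%:R^-1)) => [|i _]; last by rewrite /uniform_pmf ltn_ord.
by rewrite sumr_const card_ord -[RHS](@mulVf _ (N%:R : R)) ?pnatr_eq0 -?lt0n// mulr_natr.
Qed.

Lemma poisson_pmf_sum (R : realType) (rate : R) : 0 < rate ->
  (\sum_(0 <= n <oo) (poisson_pmf rate n)%:E = 1)%E.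
Proof.
move=> r0; rewrite nneseries_esumT => [|n]; last by rewrite lee_fin poisson_pmf_ge0.
have <- : poisson_prob rate 0 [set: nat] =
    (\esum_(k in [set: nat]) (poisson_pmf rate k)%:E)%E by rewrite /poisson_prob r0.
exact: (@probability_setT _ _ _ (poisson_prob rate 0)).
Qed.

Lemma uniform_decode d (T : measurableType d) (R : realType)
    (P : probability T R) (I : finType) (x0 : I) (Y : T -> nat) (i : I) :
  (forall S, measurable (Y @^-1` S)) ->
  (forall n, P (Y @^-1` [set n]) = (uniform_pmf R #|I| n)%:E) ->
  P [set w | nth x0 (enum I) (Y w) = i] = (#|I|%:R^-1)%:E.
Proof.
move=> mY hY.
have iI : (index i (enum I) < #|I|)%N by rewrite cardE index_mem mem_enum.
(* Numbers beyond the enumeration decode to the default [x0], but they have probability 0. *)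
pose S := [set n | nth x0 (enum I) n = i /\ (#|I| <= n)%N].
have -> : [set w | nth x0 (enum I) (Y w) = i] =
    Y @^-1` [set index i (enum I)] `|` Y @^-1` S.
  apply/seteqP; split => w /=.
    move=> Yi; have [Yn|nY] := ltnP (Y w) #|I|; [left|by right].
    by rewrite -Yi index_uniq// ?enum_uniq// -cardE.
  by move=> [->|[]//]; rewrite nth_index// mem_enum.
have S0 : P (Y @^-1` S) = 0.
  have -> : Y @^-1` S = \bigcup_(n in S) Y @^-1` [set n].
    apply/seteqP; split => [w Sw|w [n Sn /= Yn]]; first by exists (Y w).
    by rewrite /preimage/= Yn.
  rewrite measure_bigcup//.
    apply: eseries0 => n _ /set_mem[_ nI]; apply: etrans (hY n) _.
    by rewrite /uniform_pmf ltnNge nI.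
  by move=> m n _ _ [w [/= <- <-]].
rewrite measureU//.
  transitivity ((uniform_pmf R #|I| (index i (enum I)))%:E + 0)%E.
    by congr (_ + _)%E; [exact: hY|exact: S0].
  by rewrite adde0 /uniform_pmf iI.
by apply/seteqP; split => // w [/= Yi [_]]; rewrite Yi leqNgt iI.
Qed.

Section Existence.
Context {R : realType} {b : nat}.
Variables (lam : R) (hlam : 0 < lam).
Notation Ch := (choices b.+1).

(** Tuples of naturals come with [pickle], which numbers the draws; the first entry records the kind
    of draw. *)
Definition source_desc (s : source b.+1) : nat * nat * nat * nat :=
  match s with
  | SGraph => (0, 0, 0, 0)
  | SNewEdges v i j => (1, v, val i, val j)
  | SAttach u v k => (2, u, v, k)
  | SNewRoot => (3, 0, 0, 0)
  end%N.

Lemma source_desc_inj : injective source_desc.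
Proof.
case=> [|v i j|u v k|] [|v' i' j'|u' v' k'|] //.
- by move=> [-> /val_inj -> /val_inj ->].
- by move=> [-> -> ->].
Qed.

(** The sequence of independent variables needs a probability law at every index, so tuples that
    describe no draw receive one as well. *)
Definition desc_pmf (t : nat * nat * nat * nat) : nat -> R :=
  match t.1.1.1 with
  | 1%N => poisson_pmf (lam / b.+1%:R)
  | 2%N => uniform_pmf R #|{: 'I_b.+1 * 'I_b.+1}|
  | _ => uniform_pmf R #|'I_b.+1|
  end.

Lemma lam_b_gt0 : 0 < lam / b.+1%:R.
Proof. by rewrite divr_gt0. Qed.

Lemma desc_pmf_cases t :
  [\/ desc_pmf t = poisson_pmf (lam / b.+1%:R),
      desc_pmf t = uniform_pmf R #|{: 'I_b.+1 * 'I_b.+1}| |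
      desc_pmf t = uniform_pmf R #|'I_b.+1|].
Proof.
by rewrite /desc_pmf; case: t.1.1.1 => [|[|[|m]]];
  [apply: Or33|apply: Or31|apply: Or32|apply: Or33].
Qed.

Lemma source_coding : exists (code : source b.+1 -> nat) (p : nat -> nat -> R),
  [/\ injective code,
      forall j n, 0 <= p j n,
      forall j, (\sum_(0 <= n <oo) (p j n)%:E = 1)%E &
      forall s, p (code s) = desc_pmf (source_desc s)].
Proof.
exists (fun s => pickle (source_desc s)),
  (fun j => desc_pmf (odflt (0, 0, 0, 0)%N (unpickle j))); split.
- by move=> s t /(pcan_inj pickleK)/source_desc_inj.
- move=> j n; case: (desc_pmf_cases (odflt (0, 0, 0, 0)%N (unpickle j))) => ->;
  by rewrite ?poisson_pmf_ge0 ?uniform_pmf_ge0.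
- move=> j; case: (desc_pmf_cases (odflt (0, 0, 0, 0)%N (unpickle j))) => ->.
  + exact/poisson_pmf_sum/lam_b_gt0.
  + by rewrite uniform_pmf_sum// card_prod !card_ord.
  + by rewrite uniform_pmf_sum// card_ord.
- by move=> s; rewrite pickleK.
Qed.

Theorem choices_law_exists :
  exists Pc : probability Ch R,
    independent Pc (@choice_events b.+1) /\ choices_marginals lam Pc id.
Proof.
have [source_code [p [source_code_inj p0 p1 p_code]]] := source_coding.
have [d [T [P [Y [mY hY /independent_initial iY]]]]] :=
  independent_sequence_exists p0 p1.
pose dec2 := nth (ord0, ord0) (enum {: 'I_b.+1 * 'I_b.+1}).
pose dec1 := nth ord0 (enum 'I_b.+1).
pose C w : Ch := Choices
  (fun v i j => Y (source_code (SNewEdges v i j)) w)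
  (fun u v k => dec2 (Y (source_code (SAttach b.+1 u v k)) w))
  (dec1 (Y (source_code (SNewRoot b.+1)) w)).
(* Each draw is a function of the single variable at its code, so independence of the sequence
   passes to the draws. *)
have evC s A : choice_events s A ->
    exists S, C @^-1` A = Y (source_code s) @^-1` S.
  case: s => [|v i j|u v k|] /=.
  - by move=> ->; exists setT; rewrite !preimage_setT.
  - by move=> [S _ <-]; exists S.
  - by move=> [S _ <-]; exists (dec2 @^-1` S).
  - by move=> [S _ <-]; exists (dec1 @^-1` S).
have mC : measurable_fun setT C.
  by apply: measurable_choices_fun => s A /evC[S ->].
pose mu := image_measure P mC.
have muT : mu setT = 1%E.
  by rewrite -(@probability_setT _ _ _ P) -(preimage_setT C).
pose Pc : probability Ch R := HB.pack (mu : set Ch -> \bar R)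
  (Measure.class mu) (Measure_isProbability.Build _ _ _ mu muT).
have PcE A : Pc A = P (C @^-1` A) by [].
exists Pc; split.
  move=> n s s_inj A sA; rewrite PcE preimage_bigcap.
  have /choice[S hS] k := evC _ _ (sA k).
  under eq_bigcapr do rewrite hS.
  rewrite iY; last by move=> i j /source_code_inj/s_inj.
  by apply: eq_bigr => k _; rewrite PcE hS.
split => [v i j n|u v k ij|i]; rewrite PcE.
- rewrite -[X in P X]/(Y (source_code (SNewEdges v i j)) @^-1` [set n]) hY.
  by rewrite p_code.
- rewrite -[X in P X]/([set w | dec2 (Y (source_code (SAttach b.+1 u v k)) w) = ij]).
  rewrite uniform_decode//; first by rewrite card_prod !card_ord natrM expr2.
  by move=> n; rewrite hY p_code.
- rewrite -[X in P X]/([set w | dec1 (Y (source_code (SNewRoot b.+1)) w) = i]).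
  rewrite uniform_decode//; first by rewrite card_ord.
  by move=> n; rewrite hY p_code.
Qed.

End Existence.

(** * Measurability of the operation *)

Lemma measurable_ex d (T : measurableType d) (I : countType) (A : I -> set T) :
  (forall i, measurable (A i)) -> measurable [set w | exists i, A i w].
Proof.
move=> mA.
have -> : [set w | exists i, A i w] =
    \bigcup_n (if unpickle n is Some i then A i else set0).
  apply/seteqP; split => w /=.
    by move=> [i Ai]; exists (pickle i) => //; rewrite pickleK.
  by move=> [n _]; case: unpickle => // i Ai; exists i.
by apply: bigcupT_measurable => n; case: unpickle.
Qed.

Lemma measurable_all d (T : measurableType d) (I : countType) (A : I -> set T) :
  (forall i, measurable (A i)) -> measurable [set w | forall i, A i w].
Proof.
move=> mA; rewrite (_ : [set _ | _] = ~` [set w | exists i, (~` A i) w]).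
  by apply: measurableC; apply: measurable_ex => i; exact: measurableC.
by apply/seteqP; split => w /= h; [move=> [i]; exact|move=> i; apply: contrapT => nA; apply: h; exists i].
Qed.

Section Discrete.
Context d (T : measurableType d).

(** Only fibres are required to be measurable, so the target needs no sigma-algebra; for a countable
    target all preimages follow. *)
Definition discrete_rv (I : Type) (f : T -> I) : Prop :=
  forall i, measurable (f @^-1` [set i]).

Lemma discrete_cst (I : Type) (i : I) : discrete_rv (fun=> i).
Proof.
move=> j; have [ij|ij] := pselect (i = j).
  by rewrite (_ : _ @^-1` _ = setT)//; apply/seteqP; split.
by rewrite (_ : _ @^-1` _ = set0)//; apply/seteqP; split.
Qed.

(** The value of [f] selects which variable is read, as for the multiplicity of an edge at a random
    root. *)
Lemma discrete_bind (I : countType) (J : Type) (f : T -> I) (g : I -> T -> J) :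
  discrete_rv f -> (forall i, discrete_rv (g i)) ->
  discrete_rv (fun w => g (f w) w).
Proof.
move=> mf mg j.
rewrite (_ : _ @^-1` _ = [set w | exists i, (f @^-1` [set i] `&` g i @^-1` [set j]) w]).
  by apply: measurable_ex => i; apply: measurableI; [exact: mf|exact: mg].
by apply/seteqP; split => w /=; [move=> <-; exists (f w)|move=> [i [<-]]].
Qed.

Lemma discrete_comp (I : countType) (J : Type) (h : I -> J) (f : T -> I) :
  discrete_rv f -> discrete_rv (h \o f).
Proof.
move=> mf.
exact: (discrete_bind (g := fun i _ => h i) mf (fun i => discrete_cst (h i))).
Qed.

Lemma discrete_comp2 (I J : countType) (L : Type) (h : I -> J -> L) (f : T -> I)
  (g : T -> J) : discrete_rv f -> discrete_rv g ->
  discrete_rv (fun w => h (f w) (g w)).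
Proof.
move=> mf mg.
exact: (discrete_bind (g := fun i w => h i (g w)) mf (fun i => discrete_comp (h i) mg)).
Qed.

Lemma discrete_asbool (A : set T) : measurable A -> discrete_rv (fun w => w \in A).
Proof.
move=> mA [].
  rewrite (_ : _ @^-1` _ = A)//.
  by apply/seteqP; split => w /=; [move/set_mem|move/mem_set].
rewrite (_ : _ @^-1` _ = ~` A); first exact: measurableC.
apply/seteqP; split => w /=; first by move=> wA /mem_set; rewrite wA.
by move=> nA; apply/negbTE; apply: contra_notN nA => /set_mem.
Qed.

Lemma discrete_sum (F : nat -> T -> nat) n :
  (forall k, discrete_rv (F k)) -> discrete_rv (fun w => \sum_(k < n) F k w)%N.
Proof.
move=> mF; elim: n => [|n IH].
  by under eq_fun do rewrite big_ord0; exact: discrete_cst.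
by under eq_fun do rewrite big_ord_recr; exact: (discrete_comp2 addn IH (mF n)).
Qed.

Lemma measurable_discrete (I : countType) (f : T -> I) (S : set I) :
  discrete_rv f -> measurable (f @^-1` S).
Proof.
move=> /(discrete_comp (fun i => `[< S i >])) /(_ true).
rewrite (_ : _ @^-1` [set true] = f @^-1` S)//.
by apply/seteqP; split => w /= /asboolP.
Qed.

Lemma measurable_fun_discrete d' (U : measurableType d') (I : countType)
    (h : I -> U) (f : T -> I) :
  discrete_rv f -> measurable_fun setT (h \o f).
Proof.
by move=> mf _ B _; rewrite setTI comp_preimage; exact: measurable_discrete.
Qed.

Section RandomGraph.
Context (V : countType) (H : T -> rmgraph V).
Hypotheses (mroot : discrete_rv (fun w => groot (H w)))
  (mmult : forall u v, discrete_rv (fun w => mult (H w) u v)).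

(** Paths are finite sequences over a countable type, so the event is a countable union. *)
Lemma measurable_reachable u v : measurable [set w | reachable (H w) u v].
Proof.
apply: measurable_ex => p.
suff mp : discrete_rv (fun w => path (adj (H w)) u p && (last u p == v)).
  have := mp true; congr measurable; apply/seteqP; split => w /=.
    by move=> /andP[? /eqP].
  by move=> [-> ->]; rewrite eqxx.
apply: (discrete_comp2 andb) (discrete_cst _).
elim: p u => [|x p IH] u /=; first exact: discrete_cst.
exact: (discrete_comp2 andb (discrete_comp (leq 1) (mmult u x)) (IH x)).
Qed.

Lemma measurable_comp_verts v : measurable [set w | comp_verts (H w) v].
Proof.
have /(_ true) := discrete_bind mroot
  (fun u => discrete_asbool (measurable_reachable u v)).
congr measurable; apply/seteqP; split => w /=; first by move/set_mem.
by move=> h; apply/mem_set.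
Qed.

Lemma discrete_comp_verts v : discrete_rv (fun w => v \in comp_verts (H w)).
Proof. exact: discrete_asbool (measurable_comp_verts v). Qed.

Lemma discrete_comp_mult u v :
  discrete_rv (fun w => mult (component (H w)) u v).
Proof.
apply: (discrete_bind (f := fun w => (u \in comp_verts (H w)) &&
  (v \in comp_verts (H w))) (g := fun B w => if B then mult (H w) u v else 0%N)).
  exact: (discrete_comp2 andb (discrete_comp_verts u) (discrete_comp_verts v)).
by case; [exact: mmult|exact: discrete_cst].
Qed.

End RandomGraph.
End Discrete.

Notation graphs := (rmgraph nat).

Lemma measurable_verts v : measurable [set g : graphs | verts g v].
Proof. by apply: sub_sigma_algebra; left; exists v. Qed.

Lemma discrete_groot : discrete_rv (fun g : graphs => groot g).
Proof. by move=> v; apply: sub_sigma_algebra; right; left; exists v. Qed.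

Lemma discrete_mult u v : discrete_rv (fun g : graphs => mult g u v).
Proof. by move=> n; apply: sub_sigma_algebra; right; right; exists u, v, n. Qed.

Lemma measurable_gconnected : measurable [set g : graphs | gconnected g].
Proof.
apply: measurable_all => u; apply: measurable_all => v.
rewrite (_ : (fun g : graphs => _) = ~` [set g | verts g u] `|`
  (~` [set g | verts g v] `|` [set g | reachable g u v])).
  apply: measurableU; first by apply: measurableC; exact: measurable_verts.
  apply: measurableU; first by apply: measurableC; exact: measurable_verts.
  by apply: (measurable_reachable (H := id)) => *; exact: discrete_mult.
apply/seteqP; split => g /=; last by move=> [//|[//|]].
move=> h; have [gu|] := pselect (verts g u); last by left.
have [gv|] := pselect (verts g v); last by right; left.
by right; right; exact: h.
Qed.

Lemma measurable_fun_graph d (T : measurableType d) (H : T -> graphs) :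
  (forall v, measurable [set w | verts (H w) v]) ->
  discrete_rv (fun w => groot (H w)) ->
  (forall u v, discrete_rv (fun w => mult (H w) u v)) ->
  measurable_fun setT H.
Proof.
move=> hv hr hm; apply: (measurability rmgraph_cylinders) => //.
move=> _ [B [[v ->]|[[v ->]|[u [v [n ->]]]]] <-]; rewrite setTI.
- exact: hv.
- exact: hr.
- exact: hm.
Qed.

(** * Transport of the operation to graphs with vertices in [nat] *)

Section Relabel.
Context (V : Type) (dec : nat -> V) (enc : V -> nat) (encK : cancel enc dec).
Implicit Type g : rmgraph V.

Fact relabel_root g : (dec @^-1` verts g) (enc (groot g)).
Proof. by rewrite /preimage/= encK; exact: verts_root. Qed.

Fact relabel_sym g x y : mult g (dec x) (dec y) = mult g (dec y) (dec x).
Proof. exact: mult_sym. Qed.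

Fact relabel_loop g x : mult g (dec x) (dec x) = 0%N.
Proof. exact: mult_loop. Qed.

Fact relabel_in g x y :
  (0 < mult g (dec x) (dec y))%N -> (dec @^-1` verts g) x.
Proof. exact: mult_verts. Qed.

Definition relabel g : graphs :=
  RMGraph (relabel_root g) (relabel_sym g) (relabel_loop g) (@relabel_in g).

Hypothesis decK : cancel dec enc.

Lemma relabel_iso g : rooted_iso g (relabel g).
Proof.
exists enc; split => // [|u v _ _]; last by rewrite /= !encK.
split => [x /= gx|x y _ _ /(can_inj encK)//|x /= gx].
  by rewrite /preimage/= encK.
by exists (dec x); rewrite ?decK.
Qed.

End Relabel.

Section StarNat.
Context {b : nat}.
Notation Ch := (choices b.+1).

Definition copy_dec (x : nat) : nat * 'I_b.+1 :=
  (x %/ b.+1, Ordinal (ltn_pmod x (ltn0Sn b)))%N.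
Definition copy_enc (x : nat * 'I_b.+1) : nat := (x.1 * b.+1 + x.2)%N.

Lemma copy_encK : cancel copy_enc copy_dec.
Proof.
move=> [v i]; rewrite /copy_enc/copy_dec/=; congr (_, _).
  by rewrite divnMDl// divn_small ?addn0.
by apply: val_inj => /=; rewrite modnMDl modn_small.
Qed.

Lemma copy_decK : cancel copy_dec copy_enc.
Proof. by move=> x; rewrite /copy_enc/copy_dec/= -divn_eq. Qed.

(** A representative of the isomorphism class of [star g c] that depends measurably on [g] and [c];
    the operation thereby becomes a map from graphs to graphs that can be iterated. *)
Definition star_nat (g : graphs) (c : Ch) : graphs :=
  relabel copy_encK (star g c).

Lemma star_nat_iso g c : rooted_iso (star g c) (star_nat g c).
Proof. exact/relabel_iso/copy_decK. Qed.

Lemma measurable_newedges v i j n :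
  measurable [set c : Ch | newedges c v i j = n].
Proof.
by apply: (measurable_choice_events (s := SNewEdges v i j)); exists [set n].
Qed.

Lemma measurable_attach u v k ij :
  measurable [set c : Ch | attach c u v k = ij].
Proof.
by apply: (measurable_choice_events (s := SAttach _ u v k)); exists [set ij].
Qed.

Lemma measurable_newroot i : measurable [set c : Ch | newroot c = i].
Proof.
by apply: (measurable_choice_events (s := SNewRoot _)); exists [set i].
Qed.

Lemma discrete_fst d d' (T : measurableType d) (U : measurableType d')
    (I : Type) (f : T -> I) :
  discrete_rv f -> discrete_rv (fun w : T * U => f w.1).
Proof.
move=> mf i; rewrite -[X in measurable X]setTI.
exact: (measurable_fst measurableT _ (mf i)).
Qed.

Lemma discrete_snd d d' (T : measurableType d) (U : measurableType d')
    (I : Type) (f : U -> I) :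
  discrete_rv f -> discrete_rv (fun w : T * U => f w.2).
Proof.
move=> mf i; rewrite -[X in measurable X]setTI.
exact: (measurable_snd measurableT _ (mf i)).
Qed.

Lemma discrete_attach_count u v (ij : 'I_b.+1 * 'I_b.+1) :
  discrete_rv (fun w : graphs * Ch =>
    \sum_(k < mult w.1 u v) (attach w.2 u v k == ij))%N.
Proof.
apply: (discrete_bind (f := fun w : graphs * Ch => mult w.1 u v)
  (g := fun n w => \sum_(k < n) (attach w.2 u v k == ij))%N).
  exact: (discrete_fst (U := Ch) (discrete_mult u v)).
move=> n; apply: (discrete_sum (F := fun k w => (attach w.2 u v k == ij) : nat)) => k.
apply: (discrete_comp (fun x => (x == ij) : nat) (f := fun w : graphs * Ch => attach w.2 u v k)).
exact: (discrete_snd (T := graphs) (f := fun c : Ch => attach c u v k) (measurable_attach u v k)).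
Qed.

Lemma discrete_blowup_mult x y :
  discrete_rv (fun w : graphs * Ch => mult (blowup w.1 w.2) x y).
Proof.
case: x y => [u i] [v j] /=.
case: eqP => [_|_]; last by case: (u < v)%N; exact: discrete_attach_count.
have mu : discrete_rv (fun w : graphs * Ch => u \in verts w.1).
  exact: (discrete_fst (U := Ch) (discrete_asbool (measurable_verts u))).
have me i' j' : discrete_rv (fun w : graphs * Ch => newedges w.2 u i' j').
  exact: (discrete_snd (T := graphs) (f := fun c : Ch => newedges c u i' j')
    (measurable_newedges u i' j')).
apply: (discrete_bind (f := fun w : graphs * Ch => u \in verts w.1)
  (g := fun B w => if B then _ else 0%N) mu) => -[]; last exact: discrete_cst.
case: (i < j)%N; first exact: me.
case: (j < i)%N; first exact: me.
exact: discrete_cst.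
Qed.

Lemma discrete_blowup_root :
  discrete_rv (fun w : graphs * Ch => groot (blowup w.1 w.2)).
Proof.
apply: (discrete_comp2 pair (f := fun w : graphs * Ch => groot w.1)
  (g := fun w : graphs * Ch => newroot w.2)).
  exact: (discrete_fst (U := Ch) discrete_groot).
exact: (discrete_snd (T := graphs) (f := fun c : Ch => newroot c) measurable_newroot).
Qed.

Lemma measurable_star_nat :
  measurable_fun setT (fun w : graphs * Ch => star_nat w.1 w.2).
Proof.
apply: measurable_fun_graph => [v||u v].
- exact: (measurable_comp_verts discrete_blowup_root discrete_blowup_mult).
- exact: (discrete_comp copy_enc discrete_blowup_root).
- exact: (discrete_comp_mult discrete_blowup_root discrete_blowup_mult).
Qed.

End StarNat.

(** * Invariance under isomorphism *)

Lemma reachable_trans V (g : rmgraph V) u v w :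
  reachable g u v -> reachable g v w -> reachable g u w.
Proof.
move=> [p [gp <-]] [q [gq <-]]; exists (p ++ q).
by rewrite cat_path gp gq last_cat.
Qed.

Lemma reachable_verts V (g : rmgraph V) u v :
  verts g u -> reachable g u v -> verts g v.
Proof.
move=> gu [p [+ <-]]; elim: p u gu => [|x p IH] u gu //= /andP[gux gp].
apply: IH => //; rewrite /adj mult_sym in gux; exact: mult_verts gux.
Qed.

Lemma reachable_sym V (g : rmgraph V) u v : reachable g u v -> reachable g v u.
Proof.
move=> [p [+ <-]]; elim: p u => [|x p IH] u /=; first by exists [::].
move=> /andP[gux /IH xu]; apply: reachable_trans xu _; exists [:: u].
by rewrite /= andbT /adj mult_sym.
Qed.

Lemma comp_verts_sub V (g : rmgraph V) : comp_verts g `<=` verts g.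
Proof. by move=> v; apply: reachable_verts; exact: verts_root. Qed.

Lemma rooted_iso_trans U V W (g : rmgraph U) (h : rmgraph V) (k : rmgraph W) :
  rooted_iso g h -> rooted_iso h k -> rooted_iso g k.
Proof.
move=> [f [[f1 f2 f3] fr fm]] [e [[e1 e2 e3] er em]].
exists (e \o f); split => [||u v gu gv] /=; last first.
- by rewrite em ?fm//; exact: f1.
- by rewrite fr.
split => [x gx|x y gx gy /= exy|z kz]; first exact/e1/f1.
  have fx : f x \in verts h by apply/mem_set/f1/set_mem.
  have fy : f y \in verts h by apply/mem_set/f1/set_mem.
  exact: (f2 _ _ gx gy (e2 _ _ fx fy exy)).
have [y hy <-] := e3 z kz; have [x gx <-] := f3 y hy; by exists x.
Qed.

Lemma rooted_iso_sym V W (g : rmgraph V) (h : rmgraph W) :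
  rooted_iso g h -> rooted_iso h g.
Proof.
move=> [f [[f1 f2 f3] fr fm]].
have /choice[e he] : forall y, exists x, verts h y -> verts g x /\ f x = y.
  move=> y; have [hy|] := pselect (verts h y); last by exists (groot g).
  by have [x gx fx] := f3 y hy; exists x.
have fe y : verts h y -> f (e y) = y by move=> /he[].
have ge y : verts h y -> verts g (e y) by move=> /he[].
have ef x : verts g x -> e (f x) = x.
  move=> gx; have hfx := f1 x gx.
  by apply: f2; [apply/mem_set/ge|apply/mem_set|exact: fe].
exists e; split => [||u v hu hv].
- split => [y /ge//|x y /set_mem hx /set_mem hy exy|x gx].
    by rewrite -(fe x)// exy fe.
  by exists (f x); [exact: f1|exact: ef].
- by rewrite -fr ef//; exact: verts_root.
- by rewrite -fm ?fe//; exact: ge.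
Qed.

Section ComponentIso.
Context (V W : Type) (g : rmgraph V) (h : rmgraph W) (f : V -> W).
Hypotheses (fbij : set_bij (verts g) (verts h) f)
  (fmult : forall u v, verts g u -> verts g v -> mult h (f u) (f v) = mult g u v).

Lemma reachable_map u v : verts g u -> reachable g u v -> reachable h (f u) (f v).
Proof.
move=> gu [p [+ <-]]; elim: p u gu => [|x p IH] u gu /=; first by exists [::].
move=> /andP[gux gp].
have gx : verts g x by apply: (@mult_verts _ g x u); rewrite mult_sym.
apply: reachable_trans (IH _ gx gp); exists [:: f x].
by rewrite /= andbT /adj fmult.
Qed.

Lemma reachable_preimage u y : verts g u -> reachable h (f u) y ->
  exists2 v, reachable g u v & f v = y.
Proof.
move=> gu [p [+ <-]]; elim: p u gu => [|x p IH] u gu /=.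
  by move=> _; exists u => //; exists [::].
move=> /andP[hux hp]; case: fbij => _ _ fsurj.
have [z gz zx] := fsurj x (@mult_verts _ h x (f u) ltac:(by rewrite mult_sym)).
rewrite -zx in hp *; have [v vz <-] := IH _ gz hp.
exists v => //; apply: reachable_trans vz; exists [:: z].
by rewrite /= andbT /adj -fmult// zx.
Qed.

End ComponentIso.

Lemma component_iso V W (g : rmgraph V) (h : rmgraph W) :
  rooted_iso g h -> rooted_iso (component g) (component h).
Proof.
move=> [f [fb fr fm]]; have [f1 f2 f3] := fb.
have fc v : comp_verts g v -> comp_verts h (f v).
  move=> gv; rewrite /comp_verts/= -fr.
  by apply: (reachable_map fm) => //; exact: verts_root.
exists f; split => // [|u v gu gv] /=; last first.
  rewrite /comp_mult !(mem_set gu) !(mem_set gv) !mem_set ?fm//; try exact: fc.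
    exact: comp_verts_sub.
  exact: comp_verts_sub.
split => [v gv|u v /set_mem gu /set_mem gv|y hy]; first exact: fc.
  by apply: f2; apply/mem_set/comp_verts_sub.
move: hy; rewrite /comp_verts/= -fr => /(reachable_preimage fb fm (verts_root g)).
by move=> [v gv <-]; exists v.
Qed.

Lemma gconnected_iso V W (g : rmgraph V) (h : rmgraph W) :
  rooted_iso g h -> gconnected g -> gconnected h.
Proof.
move=> [f [fb fr fm]] gc u v; have [f1 f2 f3] := fb.
move=> /f3[x gx <-] /f3[y gy <-].
by apply: (reachable_map fm) => //; exact: gc.
Qed.

Lemma component_connected V (g : rmgraph V) : gconnected (component g).
Proof.
have key v : comp_verts g v -> reachable (component g) (groot g) v.
  move=> [p [gp <-]].
  suff : forall u, comp_verts g u -> path (adj g) u p ->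
    reachable (component g) u (last u p) by apply => //; exact: comp_root.
  elim: p {gp} => [|x p IH] u gu /=; first by exists [::].
  move=> /andP[gux gp].
  have gx : comp_verts g x.
    by apply: reachable_trans gu _; exists [:: x]; rewrite /= andbT.
  apply: reachable_trans (IH x gx gp); exists [:: x].
  by rewrite /= andbT /adj /= /comp_mult (mem_set gu) (mem_set gx).
move=> u v gu gv; apply: reachable_trans (key _ gv); exact/reachable_sym/key.
Qed.

Lemma star_nat_connected b (g : graphs) (c : choices b.+1) :
  gconnected (star_nat g c).
Proof. exact: gconnected_iso (star_nat_iso g c) (@component_connected _ _). Qed.

Definition isolated : set graphs := [set g | forall u, mult g (groot g) u = 0%N].

(** A connected graph with an isolated root has no other vertex. Hence these graphs form a single
    isomorphism class, to which the chain can return exactly. *)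
Lemma isolated_iso (g h : graphs) : gconnected g -> isolated g ->
  gconnected h -> isolated h -> rooted_iso g h.
Proof.
have key (k : graphs) : gconnected k -> isolated k ->
    forall v, verts k v -> v = groot k.
  move=> kc ki v kv; have [[|x p] [+ <-//]] := kc _ _ (verts_root k) kv.
  by rewrite /= /adj ki.
move=> gc gi hc hi; have Kg := key _ gc gi; have Kh := key _ hc hi.
exists (fun _ => groot h); split => // [|u v /Kg-> /Kg ->]; last by rewrite hi gi.
split => [v _|u v /set_mem/Kg -> /set_mem/Kg ->//|y /Kh ->]; first exact: verts_root.
by exists (groot g) => //; exact: verts_root.
Qed.

Lemma iso_invariantC (A : set graphs) : iso_invariant A -> iso_invariant (~` A).
Proof. by move=> Ai g h /rooted_iso_sym hg nAg /(Ai _ _ hg). Qed.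

(* An isomorphism from [g] to [h] need not extend to an injection of [nat]. But [g]
   and [h] are both isomorphic to [double_graph g] through globally injective
   maps, the one on [h] sending the non-vertices to odd numbers. *)
Section DoubleGraph.
Variable g : graphs.

Let dverts : set nat := [set x | verts g x./2 /\ ~~ odd x].
Let dmult x y := if odd x || odd y then 0%N else mult g x./2 y./2.

Fact double_graph_root : dverts (groot g).*2.
Proof. by rewrite /dverts/= doubleK odd_double; split => //; exact: verts_root. Qed.

Fact double_graph_sym x y : dmult x y = dmult y x.
Proof. by rewrite /dmult orbC mult_sym. Qed.

Fact double_graph_loop x : dmult x x = 0%N.
Proof. by rewrite /dmult mult_loop if_same. Qed.

Fact double_graph_in x y : (0 < dmult x y)%N -> dverts x.
Proof.
rewrite /dmult; case: ifPn => //; rewrite negb_or => /andP[xo _] m0.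
by split => //; exact: mult_verts m0.
Qed.

Definition double_graph : graphs := RMGraph double_graph_root
  double_graph_sym double_graph_loop double_graph_in.

End DoubleGraph.

(** * The one-step law depends only on the isomorphism class *)

Section Exchange.
Context {R : realType} {b : nat} (lam : R).
Notation Ch := (choices b.+1).
Context (Pc : probability Ch R).
Hypotheses (indP : independent Pc (@choice_events b.+1))
  (margP : choices_marginals lam Pc id).

Definition star_law (g : graphs) (A : set graphs) : \bar R :=
  Pc [set c | A (star_nat g c)].

Lemma measurable_star_nat_r (g : graphs) (A : set graphs) : measurable A ->
  measurable [set c : Ch | A (star_nat g c)].
Proof.
move=> mA; have mS := @measurable_star_nat b measurableT _ mA.
by have := measurable_xsection g mS; rewrite setTI /xsection; congr measurable;
  apply/seteqP; split => c /=; rewrite ?inE.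
Qed.

Section Rename.
Context (f : nat -> nat) (f_inj : injective f).

(* Only the pairs [u < v] matter in [attach], so that an order-reversing [f] must
   swap the two copies. *)
Definition rename_choices (c : Ch) : Ch := Choices
  (fun v => newedges c (f v))
  (fun u v k => if (u < v)%N == (f u < f v)%N then attach c (f u) (f v) k
     else let: (j, i) := attach c (f v) (f u) k in (i, j))
  (newroot c).

Definition rename_source (s : source b.+1) : source b.+1 :=
  match s with
  | SGraph => SGraph _
  | SNewEdges v i j => SNewEdges (f v) i j
  | SAttach u v k => if (u < v)%N == (f u < f v)%N then SAttach _ (f u) (f v) k
                     else SAttach _ (f v) (f u) k
  | SNewRoot => SNewRoot _
  end.

Lemma order_preserved_sym u v :
  ((u < v) == (f u < f v))%N = ((v < u) == (f v < f u))%N.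
Proof.
have [->//|uv] := eqVneq u v.
have fuv : f u != f v by rewrite (inj_eq f_inj).
by move: uv fuv; case: ltngtP => // _ _; case: ltngtP.
Qed.

(** Two attachment draws could collide only if they concern the same pair in opposite orders and
    exactly one of them is swapped; but whether [f] preserves the order of a pair does not depend on
    how the pair is listed. *)
Lemma rename_source_inj : injective rename_source.
Proof.
case=> [|v i j|u v k|] [|v' i' j'|u' v' k'|] //=; try by case: ifP.
  by move=> [/f_inj -> -> ->].
case: ifP => E; case: ifP => E'; move=> [/f_inj Eu /f_inj Ev ->]; subst => //;
  by move: E E'; rewrite order_preserved_sym => ->.
Qed.

Lemma rename_events s A : choice_events s A ->
  choice_events (rename_source s) (rename_choices @^-1` A).
Proof.
case: s => [|v i j|u v k|] /=.
- by move=> ->.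
- by move=> [S _ <-]; exists S.
- move=> [S _ <-]; case: ifP => uv; first by exists S => //; rewrite /preimage/= uv.
  exists [set ji | S (ji.2, ji.1)] => //.
  by apply/funext => c; rewrite /preimage/= uv; case: attach.
- by move=> [S _ <-]; exists S.
Qed.

Lemma measurable_rename : measurable_fun setT rename_choices.
Proof.
apply: measurable_choices_fun => s A /rename_events.
exact: measurable_choice_events.
Qed.

Lemma rename_marginals : choices_marginals lam Pc rename_choices.
Proof.
case: margP => h1 h2 h3; split => [v i j n|u v k [i j]|i] /=.
- exact: h1.
- case: ((u < v)%N == (f u < f v)%N); first exact: h2.
  rewrite -(h2 (f v) (f u) k (j, i)); congr (Pc _).
  apply/seteqP; split => c /=; first by case: attach => ? ? [-> ->].
  by move=> ->.
- exact: h3.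
Qed.

(** Injectivity of [rename_source] keeps the renamed draws independent, and swapping the two entries
    preserves the uniform law of an attachment. *)
Lemma rename_law B : measurable B -> Pc (rename_choices @^-1` B) = Pc B.
Proof.
move=> mB.
have := @choices_law_unique R b Pc _ _ Pc setT rename_choices measurableT
  measurable_rename _ indP B mB.
rewrite probability_setT setTI mul1e; apply => A l hA ul.
rewrite setTI mul1e (independent_seq (phi := rename_source) indP)//; last 2 first.
- exact: rename_source_inj.
- by move=> s; exact: rename_events.
apply: eq_bigr => s _.
exact: (choices_marginals_eq measurable_rename _ rename_marginals margP (hA s)).
Qed.

Lemma blowup_rename (g k : graphs) (c : Ch) :
  set_bij (verts g) (verts k) f -> f (groot g) = groot k ->
  (forall u v, verts g u -> verts g v -> mult k (f u) (f v) = mult g u v) ->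
  rooted_iso (blowup g (rename_choices c)) (blowup k c).
Proof.
move=> [f1 f2 f3] fr fm.
exists (fun x => (f x.1, x.2)); split => /=; last 2 first.
- by rewrite fr.
- move=> [u i] [v j]; rewrite /blowup_verts/= => gu gv.
  have [->|uv] := eqVneq u v.
    by rewrite !eqxx (mem_set gv) (mem_set (f1 _ gv)).
  rewrite (inj_eq f_inj) (negPf uv).
  have fuv : f u != f v by rewrite (inj_eq f_inj).
  have sw (p : 'I_b.+1 * 'I_b.+1) i' j' :
    ((let: (j, i) := p in (i, j)) == (i', j')) = (p == (j', i')).
    by case: p => a d; rewrite !xpair_eqE andbC.
  rewrite !fm// (mult_sym g v u).
  case: (ltngtP u v) uv => // uv _; case: (ltngtP (f u) (f v)) fuv => // fuv _;
    by apply: eq_bigr => n _; rewrite /= ?sw.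
split => [x|x y|[y i]]; rewrite /blowup_verts/=.
- exact: f1.
- by case: x y => [u i] [v j] _ _ /= [/f_inj -> ->].
- by move=> /f3[x gx <-]; exists (x, i).
Qed.

Lemma star_law_rename (g k : graphs) A :
  set_bij (verts g) (verts k) f -> f (groot g) = groot k ->
  (forall u v, verts g u -> verts g v -> mult k (f u) (f v) = mult g u v) ->
  measurable A -> iso_invariant A -> star_law g A = star_law k A.
Proof.
move=> fb fr fm mA Ai; rewrite /star_law.
rewrite -(rename_law (measurable_star_nat_r g mA)); congr (Pc _).
have iso c : rooted_iso (star_nat g (rename_choices c)) (star_nat k c).
  apply: rooted_iso_trans (rooted_iso_sym (star_nat_iso _ _)) _.
  apply: rooted_iso_trans (star_nat_iso _ _).
  exact/component_iso/blowup_rename.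
apply/seteqP; split => c /=; first exact: Ai (iso c).
exact: Ai (rooted_iso_sym (iso c)).
Qed.

End Rename.

Lemma star_law_iso (g h : graphs) A : rooted_iso g h ->
  measurable A -> iso_invariant A -> star_law g A = star_law h A.
Proof.
move=> gh mA Ai.
have [e [[e1 e2 e3] er em]] := rooted_iso_sym gh.
pose F v := if v \in verts h then (e v).*2 else v.*2.+1.
have Fh v : verts h v -> F v = (e v).*2 by move=> /mem_set hv; rewrite /F hv.
have F_inj : injective F.
  move=> u v; rewrite /F.
  case: ifPn => hu; case: ifPn => hv; move=> /(congr1 (fun n => (odd n, n./2)));
    rewrite /= ?odd_double ?doubleK ?uphalf_double //; move=> [] //.
  exact: e2.
transitivity (star_law (double_graph g) A).
  apply: (star_law_rename (f := double)) => //; first exact: can_inj doubleK.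
    split => [v gv|u v _ _ /(can_inj doubleK)//|x [gx xo]].
      by rewrite /= odd_double doubleK.
    by exists x./2 => //; rewrite even_halfK.
  by move=> u v _ _; rewrite /= !odd_double !doubleK.
apply/esym/(star_law_rename F_inj) => //.
- split => [v hv|u v _ _ /F_inj//|x [gx xo]].
    by rewrite Fh//= odd_double doubleK; split => //; exact: e1.
  have [v hv ev] := e3 _ gx; exists v => //.
  by rewrite Fh// ev even_halfK.
- by rewrite Fh ?er//; exact: verts_root.
- by move=> u v hu hv; rewrite !Fh//= !odd_double !doubleK em.
Qed.

End Exchange.

(** * The probability of isolating the root *)

Definition root_degree (R : realType) (g : graphs) : \bar R :=
  degree R g (groot g).

Section RootDegree.
Context {R : realType}.
Local Open Scope ereal_scope.

Lemma nat_ge0 (n : nat) : 0 <= (n%:R : R)%:E.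
Proof. by rewrite lee_fin. Qed.

Lemma root_degree_ge0 g : 0 <= root_degree R g.
Proof. by apply: nneseries_ge0 => n _ _; exact: nat_ge0. Qed.

Lemma root_degree0 g : isolated g -> root_degree R g = 0.
Proof. by move=> gi; apply: eseries0 => n _ _; rewrite gi. Qed.

Lemma measurable_root_degree : measurable_fun setT (@root_degree R).
Proof.
rewrite /root_degree /degree.
apply: (ge0_emeasurable_sum (P := xpredT)) => [n g _ _|n _]; first exact: nat_ge0.
apply: (measurable_fun_discrete (fun m : nat => (m%:R : R)%:E)
  (f := fun g : graphs => mult g (groot g) n)).
exact: (discrete_bind (g := fun v (g : graphs) => mult g v n) discrete_groot
  (fun v => discrete_mult v n)).
Qed.

Lemma measurable_isolated : measurable isolated.
Proof.
apply: measurable_all => n.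
exact: (discrete_bind (g := fun v (g : graphs) => mult g v n) discrete_groot
  (fun v => discrete_mult v n) 0%N).
Qed.

(** The partial sums of the degree are naturals bounded by [M]. Past an index [N] where they reach
    their maximum, the root has no further edge. *)
Lemma root_degree_support g (M : nat) : root_degree R g <= (M%:R)%:E ->
  exists N : nat, (forall u, (N <= u)%N -> mult g (groot g) u = 0%N) /\
    (\sum_(u < N) mult g (groot g) u <= M)%N.
Proof.
move=> gM; pose S n := (\sum_(u < n) mult g (groot g) u)%N.
have SM n : (S n <= M)%N.
  rewrite -(ler_nat R) -lee_fin; apply: le_trans gM.
  apply: le_trans (nneseries_lim_ge n _); last by move=> *; exact: nat_ge0.
  by rewrite sumEFin big_mkord natr_sum.
pose P m := `[< exists n, S n = m >].
have exP : exists m, P m by exists (S 0%N); apply/asboolP; exists 0%N.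
have PM m : P m -> (m <= M)%N by move=> /asboolP[n <-].
case: (ex_maxnP exP PM) => m /asboolP[N SN] mmax.
exists N; split; last by rewrite -/(S N).
move=> u Nu; apply/eqP; rewrite -leqn0 -(leq_add2l (S N)) addn0.
apply: leq_trans (_ : S u.+1 <= _)%N; last by rewrite SN mmax//; apply/asboolP; exists u.+1.
rewrite /S big_ord_recr/= leq_add2r -!(big_mkord xpredT (mult g (groot g))).
by rewrite [leqRHS](big_cat_nat (n := N))//= leq_addr.
Qed.

End RootDegree.

Lemma comp_mult_le V (g : rmgraph V) u v : (comp_mult g u v <= mult g u v)%N.
Proof. by rewrite /comp_mult; case: ifP. Qed.

Section Minorization.
Context {R : realType} {b : nat} (hb : (0 < b)%N) (lam : R) (hlam : 0 < lam).
Notation Ch := (choices b.+1).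
Context (Pc : probability Ch R).
Hypotheses (indP : independent Pc (@choice_events b.+1))
  (margP : choices_marginals lam Pc id).

(* On these events the copy [ord0] of the root [o] is the new root, and no edge is
   attached to it. *)
Definition avoid_event (o : nat) (s : source b.+1) : set Ch :=
  match s with
  | SGraph => setT
  | SNewEdges v i j => [set c | newedges c v i j = 0%N]
  | SAttach u v k => if u == o then [set c | (attach c u v k).1 != ord0]
                     else [set c | (attach c u v k).2 != ord0]
  | SNewRoot => [set c | newroot c = ord0]
  end.

Lemma avoid_event_choice o s : choice_events s (avoid_event o s).
Proof.
case: s => [|v i j|u v k|] //=.
- by exists [set 0%N].
- by case: ifP => _; [exists [set ij | ij.1 != ord0]|exists [set ij | ij.2 != ord0]].
- by exists [set ord0].
Qed.

Lemma avoid_event_lower : exists2 theta : R, 0 < theta <= 1 &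
  forall o s, (theta%:E <= Pc (avoid_event o s))%E.
Proof.
have b0 : 0 < b.+1%:R^-1 :> R by rewrite invr_gt0.
have b1 : b.+1%:R^-1 <= 1 :> R by rewrite invf_le1// ler1n.
pose e := expR (- (lam / b.+1%:R)).
have e0 : 0 < e by exact: expR_gt0.
have e1 : e <= 1 by rewrite -expR0 ler_expR oppr_le0 divr_ge0// ltW.
have bb0 : 0 < (b.+1%:R ^+ 2)^-1 :> R by rewrite -exprVn exprn_gt0.
have bb1 : (b.+1%:R ^+ 2)^-1 <= b.+1%:R^-1 :> R.
  by rewrite -exprVn expr2 ler_piMl// ltW.
(* A common lower bound: the new root is [ord0] with probability [1 / b.+1], a number of new edges
   vanishes with probability [e], and an attachment avoids [ord0] with probability at least
   [1 / b.+1 ^ 2]. *)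
exists ((b.+1%:R ^+ 2)^-1 * e).
  by rewrite mulr_gt0//= mulr_ile1// ?(ltW bb0) ?(ltW e0)//; exact: le_trans b1.
have T2 : (((b.+1%:R ^+ 2)^-1 * e)%:E <= ((b.+1%:R ^+ 2)^-1 : R)%:E)%E.
  by rewrite lee_fin ler_piMr// ltW.
case: margP => h1 h2 h3.
(* There is a second copy; an edge attached to copy 1 at both ends avoids [ord0], whichever end lies
   at the root. *)
have c1 : (1 < b.+1)%N by [].
have one : (Ordinal c1 : 'I_b.+1) != ord0 by [].
move=> o [|v i j|u v k|].
- rewrite probability_setT; apply: le_trans T2 _.
  by rewrite lee_fin; exact: le_trans b1.
- have -> : Pc (avoid_event o (SNewEdges v i j)) = (poisson_pmf (lam / b.+1%:R) 0)%:E.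
    exact: h1.
  rewrite lee_fin /poisson_pmf divr_gt0// expr0 fact0 invr1 !mul1r.
  by rewrite ler_piMl ?(ltW e0)//; exact: le_trans b1.
- apply: le_trans T2 _; rewrite -(h2 u v k (Ordinal c1, Ordinal c1)).
  have mA := @measurable_choice_events _ (SAttach _ u v k) _
    (avoid_event_choice o (SAttach _ u v k)).
  apply: le_measure; rewrite ?inE//; first exact: measurable_attach.
  by rewrite /avoid_event; case: ifP => _ c /= ->.
- have -> : Pc (avoid_event o (SNewRoot _)) = (b.+1%:R^-1)%:E by exact: h3.
  by apply: le_trans T2 _; rewrite lee_fin.
Qed.

Definition attach_source (o u k : nat) : source b.+1 :=
  if (o < u)%N then SAttach _ o u k else SAttach _ u o k.

(** If all neighbours of the root are below [N], these finitely many draws control every edge at the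
    copy [ord0] of the root. *)
Definition avoid_sources (g : graphs) (N : nat) : seq (source b.+1) :=
  SNewRoot _ :: [seq SNewEdges (groot g) ord0 j | j <- enum 'I_b.+1] ++
  [seq attach_source (groot g) u k | u <- iota 0 N, k <- iota 0 (mult g (groot g) u)].

Lemma avoid_sources_uniq g N : uniq (avoid_sources g N).
Proof.
have notroot s : s \in [seq attach_source (groot g) u k | u <- iota 0 N,
    k <- iota 0 (mult g (groot g) u)] -> exists u v k, s = SAttach b.+1 u v k.
  move=> /allpairsPdep[u [k [_ _ ->]]]; rewrite /attach_source.
  by case: ifP => _; [exists (groot g), u, k|exists u, (groot g), k].
rewrite /avoid_sources cons_uniq mem_cat negb_or cat_uniq; apply/and4P; split.
- apply/andP; split; first by apply/mapP => -[].
  by apply/negP => /notroot[u [v [k]]].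
- by rewrite map_inj_uniq ?enum_uniq// => i j [].
- by apply/hasP => -[s /notroot[u [v [k ->]]]] /mapP[j].
apply: allpairs_uniq_dep => [|u _|[u k] [v l] _ _]; rewrite ?iota_uniq//=.
rewrite /attach_source; case: ifP => ou; case: ifP => ov => -[].
- by move=> -> ->.
- by move=> <- uo; rewrite uo ltnn in ou.
- by move=> -> vo; rewrite vo ltnn in ov.
- by move=> -> ->.
Qed.

Lemma size_avoid_sources g N :
  size (avoid_sources g N) = (b.+2 + \sum_(u < N) mult g (groot g) u)%N.
Proof.
rewrite /avoid_sources /= size_cat size_map size_enum_ord !addSn; congr (b + _).+2%N.
rewrite size_allpairs_dep sumnE big_map -(big_mkord xpredT (mult g (groot g))).
by rewrite /index_iota subn0; apply: eq_bigr => u _; rewrite size_iota.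
Qed.

Lemma avoid_sources_isolated g N c :
  (forall u, (N <= u)%N -> mult g (groot g) u = 0%N) ->
  (\bigcap_(s in [set` avoid_sources g N]) avoid_event (groot g) s) c ->
  isolated (star_nat g c).
Proof.
move=> gN h.
have hr : newroot c = ord0 by apply: (h (SNewRoot _)); rewrite /= inE eqxx.
have he j : newedges c (groot g) ord0 j = 0%N.
  apply: (h (SNewEdges (groot g) ord0 j)); rewrite /= inE mem_cat.
  by apply/orP; right; apply/orP; left; rewrite map_f ?mem_enum.
have ha u k : (k < mult g (groot g) u)%N ->
    avoid_event (groot g) (attach_source (groot g) u k) c.
  move=> ku; apply: h; rewrite /= inE mem_cat; apply/orP; right; apply/orP; right.
  apply/allpairsPdep; exists u, k; rewrite !mem_iota/= !add0n; split => //.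
  by rewrite ltnNge; apply/negP => /gN u0; rewrite u0 in ku.
(* Passing to the component does not create edges, so the whole blow-up may be considered. *)
suff iso x : mult (blowup g c) (groot (blowup g c)) x = 0%N.
  move=> x; apply/eqP; rewrite -leqn0 /= copy_encK.
  by apply: leq_trans (comp_mult_le _ _ _) _; rewrite leqn0; apply/eqP/iso.
case: x => [v j] /=; rewrite hr.
case: eqP => [_|/eqP ov]; first by case: ifP => // _; rewrite ltn0 he if_same.
have [lov|] := ltnP (groot g) v.
  rewrite big1// => k _; have := ha v k (ltn_ord k).
  rewrite /attach_source lov /= eqxx /=.
  by case: attach => a d /=; rewrite xpair_eqE => /negbTE ->.
rewrite leq_eqVlt eq_sym (negPf ov) /= => lvo.
rewrite big1// => k _; have kv := ltn_ord k; rewrite [X in (_ < X)%N]mult_sym in kv.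
have := ha v k kv.
rewrite /attach_source ltnNge (ltnW lvo) /= eq_sym (negPf ov) /=.
by case: attach => a d /=; rewrite xpair_eqE => /negbTE ->; rewrite andbF.
Qed.

(** By independence the bound is [theta] to the number of draws involved: one for the new root,
    [b.+1] for new edges, and at most [M] for the old edges of the root. *)
Lemma isolation_lower : exists2 theta : R, 0 < theta <= 1 &
  forall g (M : nat), (root_degree R g <= (M%:R)%:E)%E ->
    ((theta ^+ (b.+2 + M))%:E <= star_law Pc g isolated)%E.
Proof.
have [theta /andP[t0 t1] ht] := avoid_event_lower.
exists theta; rewrite ?t0// => g M /root_degree_support[N [gN sM]].
have ul := avoid_sources_uniq g N.
have mI : measurable (\bigcap_(s in [set` avoid_sources g N]) avoid_event (groot g) s).
  rewrite bigcap_seq; apply: bigsetI_measurable => s _.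
  exact: measurable_choice_events (avoid_event_choice (groot g) s).
apply: le_trans (_ : Pc (\bigcap_(s in [set` avoid_sources g N])
    avoid_event (groot g) s) <= _)%E; last first.
  apply: le_measure; rewrite ?inE//.
    exact: measurable_star_nat_r measurable_isolated.
  by move=> c; exact: avoid_sources_isolated.
rewrite (independent_seq (phi := id) indP)//; last first.
  by move=> s; exact: avoid_event_choice.
apply: le_trans (_ : (theta ^+ size (avoid_sources g N))%:E <= _)%E.
  by rewrite lee_fin ler_wiXn2l ?(ltW t0)// size_avoid_sources leq_add2l.
elim: (avoid_sources g N) => [|s l IH]; first by rewrite big_nil.
rewrite big_cons /= exprS EFinM; apply: lee_pmul => //.
  by rewrite lee_fin ltW.
by rewrite lee_fin exprn_ge0// ltW.
Qed.

End Minorization.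

(** * The expected root degree after one step *)

Lemma measurable_natr (R : realType) d (T : measurableType d) (X : T -> nat) :
  discrete_rv X -> measurable_fun setT (fun w => ((X w)%:R : R)%:E).
Proof. exact: (measurable_fun_discrete (fun m : nat => (m%:R : R)%:E)). Qed.

(** A crude bound on the mean, enough for the drift. Since [n <= 2 ^ n], the term
    [n * poisson_pmf r n] is at most [expR r * poisson_pmf (2 * r) n], and the masses of the second
    law sum to 1. *)
Lemma integral_poisson_le d (T : measurableType d) (R : realType)
    (P : probability T R) (X : T -> nat) (r : R) : 0 < r ->
  discrete_rv X ->
  (forall n, P (X @^-1` [set n]) = (poisson_pmf r n)%:E) ->
  (\int[P]_w ((X w)%:R : R)%:E <= (expR r)%:E)%E.
Proof.
move=> r0 mX hX.
have cover : \bigcup_n (X @^-1` [set n]) = setT.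
  by apply/seteqP; split => // w _; exists (X w).
rewrite -cover ge0_integral_bigcup//; last 2 first.
- rewrite cover; exact: (measurable_natr mX).
- by move=> i j _ _ [w [/= <- <-]].
have r2 : 0 < 2 * r by rewrite mulr_gt0.
rewrite -[leRHS]mule1 -(poisson_pmf_sum r2) -nneseriesZl; last first.
  by move=> n _; rewrite lee_fin poisson_pmf_ge0.
apply: lee_nneseries => [n _ _|n _]; first exact: integral_ge0.
rewrite (eq_integral (cst (n%:R : R)%:E)); last by move=> w; rewrite inE => ->.
rewrite integral_cst//.
have -> : ((n%:R : R)%:E * P (X @^-1` [set n]) =
  (n%:R : R)%:E * (poisson_pmf r n)%:E)%E by congr (_ * _)%E; exact: hX.
rewrite -!EFinM lee_fin /poisson_pmf r0 r2.
have -> : expR (- r) = expR r * expR (- (2 * r)).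
  by rewrite -expRD mulr2n mulrDl mul1r opprD addrA subrr add0r.
rewrite [leRHS](_ : _ = 2 ^+ n * (r ^+ n / n`!%:R * (expR r * expR (- (2 * r))))).
  rewrite ler_wpM2r//; last by rewrite -natrX ler_nat ltnW// ltn_expl.
  by rewrite !mulr_ge0 ?expR_ge0// ?invr_ge0// exprn_ge0// ltW.
by rewrite exprMn -!mulrA mulrCA; congr (_ * _); rewrite mulrCA; congr (_ * _); rewrite mulrCA.
Qed.

Section Drift.
Context {R : realType} {b : nat} (lam : R) (hlam : 0 < lam).
Notation Ch := (choices b.+1).
Context (Pc : probability Ch R).
Hypotheses (indP : independent Pc (@choice_events b.+1))
  (margP : choices_marginals lam Pc id).
Local Open Scope ereal_scope.

Let r := (lam / b.+1%:R)%R.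
Let B := (b.+1%:R : R).

Lemma integral_newedges_le v i j :
  \int[Pc]_c ((newedges c v i j)%:R : R)%:E <= (expR r)%:E.
Proof.
apply: integral_poisson_le; first by rewrite divr_gt0.
  exact: measurable_newedges.
by case: margP => h1 _ _ n; exact: h1.
Qed.

(* The contraction factor [1 / b] of the drift comes from the independence of the
   new root: an old edge joins the new root to a given copy of its other end with
   probability [1 / b ^ 2], and there are [b] such copies. *)
Lemma attach_newroot u v k (h : 'I_b.+1 -> 'I_b.+1 * 'I_b.+1) :
  Pc [set c | attach c u v k = h (newroot c)] = ((B ^+ 2)^-1)%:E.
Proof.
case: margP => _ h2 h3.
pose A i (s : source b.+1) : set Ch := match s with
  | SNewRoot => [set c | newroot c = i]
  | SAttach u v k => [set c | attach c u v k = h i]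
  | _ => setT end.
have AE i s : choice_events s (A i s).
  case: s => [|v' i' j'|u' v' k'|] //=.
  - by exists setT.
  - by exists [set h i].
  - by exists [set i].
pose l : seq (source b.+1) := [:: SNewRoot _; SAttach _ u v k].
have ul : uniq l by rewrite /= andbT inE; apply/eqP.
have mA i s : measurable (A i s) := measurable_choice_events (AE i s).
have -> : [set c | attach c u v k = h (newroot c)] =
    \big[setU/set0]_(i < b.+1) (A i (SNewRoot _) `&` A i (SAttach _ u v k)).
  rewrite -bigcup_seq; apply/seteqP; split => c /=.
    by move=> hc; exists (newroot c) => /=; [exact: mem_index_enum|split].
  by move=> [i _ [<- ->]].
rewrite measure_bigsetU_ord//; last 2 first.
- by move=> i; exact: measurableI.
- by move=> i j _ _ [c [[/= <- _] [/= <- _]]].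
have E i : Pc (A i (SNewRoot _) `&` A i (SAttach _ u v k)) = (B^-1 * (B ^+ 2)^-1)%:E.
  have := independent_seq (phi := id) indP (fun _ _ => id) ul (AE i).
  rewrite !big_cons big_nil mule1 [Pc (A i (SNewRoot _))]h3 [Pc (A i (SAttach _ u v k))]h2.
  rewrite -EFinM => <-; congr (Pc _).
  by rewrite bigcap_seq !big_cons big_nil setIT.
rewrite (eq_bigr (fun=> (B^-1 * (B ^+ 2)^-1)%:E)); last by move=> i _; exact: E.
rewrite sumEFin sumr_const card_ord -mulr_natl mulrA mulfV ?mul1r//.
Qed.

Lemma integral_attach_count n u v (h : 'I_b.+1 -> 'I_b.+1 * 'I_b.+1) :
  \int[Pc]_c ((\sum_(k < n) (attach c u v k == h (newroot c)))%:R : R)%:E =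
  (n%:R / B ^+ 2)%:E.
Proof.
pose E k : set Ch := [set c | attach c u v k = h (newroot c)].
have mE k : measurable (E k).
  have := discrete_comp2 (fun x y => x == h y) (measurable_attach u v k)
    (@measurable_newroot b) true.
  by congr measurable; apply/seteqP; split => c /= /eqP.
transitivity (\int[Pc]_c (\sum_(k < n) (\1_(E k) c : R)%:E)).
  apply: eq_integral => c _; rewrite natr_sum -sumEFin; apply: eq_bigr => k _.
  rewrite indicE; congr (_%:R%:E); congr nat_of_bool.
  by apply/eqP/idP => [?|/set_mem//]; exact/mem_set.
rewrite ge0_integral_sum//=; last first.
  by move=> k; apply/measurable_EFinP; exact: measurable_indic.
rewrite (eq_bigr (fun=> ((B ^+ 2)^-1)%:E)) => [|k _]; last first.
  by rewrite integral_indic// setIT; exact: attach_newroot.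
by rewrite sumEFin sumr_const card_ord mulr_natl.
Qed.

Lemma discrete_section (I : Type) (g : graphs) (F : graphs * Ch -> I) :
  discrete_rv F -> discrete_rv (fun c => F (g, c)).
Proof.
move=> mF i; rewrite -[X in measurable X]setTI.
exact: (pair1_measurable g measurableT (mF i)).
Qed.

Lemma discrete_blowup_degree g x :
  discrete_rv (fun c : Ch => mult (blowup g c) (groot (blowup g c)) x).
Proof.
apply: (discrete_bind (f := @newroot b.+1)
  (g := fun i c => mult (blowup g c) (groot g, i) x)).
  exact: measurable_newroot.
by move=> i; exact: (discrete_section g (discrete_blowup_mult (groot g, i) x)).
Qed.

(** Bounds the expected number of new edges from the new root to one given copy of the old root: the
    random copy [i] is replaced by a sum over all [B] copies, with one Poisson variable for each
    order of the two indices. *)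
Let kappa : R := ((expR r + expR r) * B)%R.

Let copy_bound (g : graphs) (v : nat) : R := ((if v == groot g then kappa else 0) +
  (mult g (groot g) v)%:R / B ^+ 2)%R.

Let copy_bound_ge0 g v : (0 <= copy_bound g v)%R.
Proof.
rewrite /copy_bound addr_ge0 ?divr_ge0 ?exprn_ge0//; case: ifP => // _.
by rewrite mulr_ge0// addr_ge0 ?expR_ge0.
Qed.

Lemma integral_blowup_degree_le g x :
  \int[Pc]_c ((mult (blowup g c) (groot (blowup g c)) x)%:R : R)%:E <=
  (copy_bound g x.1)%:E.
Proof.
have mh (y : nat * 'I_b.+1) : measurable_fun setT
    (fun c : Ch => ((mult (blowup g c) (groot (blowup g c)) y)%:R : R)%:E).
  exact: (measurable_natr (discrete_blowup_degree g y)).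
case: x => v j; rewrite /copy_bound [(v, j).1]/=.
have [->|vo] := eqVneq v (groot g).
  rewrite mult_loop mul0r addr0.
  pose X (i k : 'I_b.+1) (c : Ch) := ((newedges c (groot g) i k)%:R : R)%:E.
  have mX i k : measurable_fun setT (X i k).
    exact: (measurable_natr (measurable_newedges (groot g) i k)).
  have X0 i k c : 0 <= X i k c by exact: nat_ge0.
  have mXX i : measurable_fun setT (fun c => X i j c + X j i c).
    exact: emeasurable_funD.
  apply: (@le_trans _ _ (\int[Pc]_c (\sum_(i < b.+1) (X i j c + X j i c)))).
    apply: ge0_le_integral => //.
    - exact: (emeasurable_sum (h := fun i c => X i j c + X j i c) _ mXX).
    (* The summand at the actual new root already dominates; it contains both orders because
       [newedges] is read at the increasing one. *)
    - move=> c _; rewrite (bigD1 (newroot c))//=.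
      rewrite -[leLHS]adde0; apply: leeD; last first.
        by apply: sume_ge0 => i _; exact: adde_ge0.
      rewrite /= eqxx (mem_set (verts_root g)) /X.
      by case: ifP => _; [rewrite leeDl//; exact: nat_ge0
        |case: ifP => _; [rewrite leeDr//; exact: nat_ge0|exact: adde_ge0]].
  rewrite ge0_integral_sum//; last by move=> i c _; exact: adde_ge0.
  apply: (@le_trans _ _ (\sum_(i < b.+1) (expR r + expR r)%:E)).
    apply: lee_sum => i _; rewrite ge0_integralD// EFinD.
    by apply: leeD; exact: integral_newedges_le.
  by rewrite sumEFin sumr_const card_ord /kappa mulr_natr.
rewrite add0r /= (eq_sym (groot g)) (negPf vo).
have [lov|_] := ltnP (groot g) v.
  by rewrite (integral_attach_count _ _ _ (fun i => (i, j))).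
by rewrite (integral_attach_count _ _ _ (fun i => (j, i))) mult_sym.
Qed.

(** The copies of [v] are numbered by [B] consecutive integers. Partial sums are extended to a
    multiple of [B] terms, which group into complete sets of copies. *)
Lemma sum_copies_le (F : nat -> R) (s : \bar R) : (forall v, (0 <= F v)%R) ->
  (forall N, (\sum_(v < N) F v)%:E <= s) ->
  \sum_(0 <= x <oo) (F (x %/ b.+1)%N)%:E <= B%:E * s.
Proof.
move=> F0 Fs; apply: lime_le.
  by apply: is_cvg_nneseries => n _ _; rewrite lee_fin.
apply: nearW => N.
have NB : (N <= N * b.+1)%N by rewrite leq_pmulr.
apply: (@le_trans _ _ (\sum_(0 <= x < N * b.+1) (F (x %/ b.+1)%N)%:E)).
  rewrite [leRHS](big_cat_nat (n := N))//= leeDl// sume_ge0// => x _.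
  by rewrite lee_fin.
rewrite sumEFin.
have -> : (\sum_(0 <= x < N * b.+1) F (x %/ b.+1)%N = B * \sum_(v < N) F v)%R.
  elim: N {NB} => [|N IH]; first by rewrite mul0n big_nil big_ord0 mulr0.
  rewrite mulSn addnC (@big_cat_nat _ _ _ (N * b.+1)%N)//=; last exact: leq_addr.
  rewrite IH big_ord_recr/= mulrDr; congr (_ + _)%R.
  rewrite -{1}[(N * b.+1)%N]add0n big_addn addKn big_mkord.
  rewrite (eq_bigr (fun=> F N)) => [|i _]; last first.
    by rewrite addnC divnMDl// divn_small ?addn0.
  by rewrite sumr_const card_ord mulr_natl.
by rewrite EFinM lee_wpmul2l// lee_fin.
Qed.

(** Each old edge of the root contributes at most [1 / B ^ 2] for each of the [B] copies of its
    other end, which gives the factor [1 / B]; the copies of the root itself contribute at most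
    [B * kappa]. *)
Lemma star_degree_drift g :
  \int[Pc]_c root_degree R (star_nat g c) <=
  (B^-1)%:E * root_degree R g + (B * kappa)%:E.
Proof.
pose h (x : nat) (c : Ch) :=
  ((mult (blowup g c) (groot (blowup g c)) (copy_dec x))%:R : R)%:E.
have mh x : measurable_fun setT (h x).
  exact: (measurable_natr (discrete_blowup_degree g (copy_dec x))).
have h0 x c : 0 <= h x c by exact: nat_ge0.
apply: (@le_trans _ _ (\int[Pc]_c (\sum_(0 <= x <oo) h x c))).
  apply: ge0_le_integral => //.
  - by move=> c _; exact: root_degree_ge0.
  - apply: measurableT_comp; first exact: measurable_root_degree.
    have := measurableT_comp (@measurable_star_nat b) (pair1_measurable g).
    exact.
  - by apply: (ge0_emeasurable_sum (P := xpredT)).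
  - move=> c _; apply: lee_nneseries => [x _ _|x _]; first exact: nat_ge0.
    by rewrite lee_fin ler_nat /= copy_encK; exact: comp_mult_le.
rewrite integral_nneseries//.
apply: (@le_trans _ _ (\sum_(0 <= x <oo) (copy_bound g (x %/ b.+1)%N)%:E)).
  apply: lee_nneseries => [x _ _|x _]; first exact: integral_ge0.
  exact: (integral_blowup_degree_le g (copy_dec x)).
apply: le_trans (sum_copies_le (s := (kappa)%:E + ((B ^+ 2)^-1)%:E * root_degree R g) _ _) _.
- exact: copy_bound_ge0.
- move=> N; rewrite big_split/= EFinD; apply: leeD.
    rewrite lee_fin -big_mkcond/=.
    have [gN|Ng] := ltnP (groot g) N.
      by rewrite (big_pred1 (Ordinal gN)).
    rewrite big_pred0 => [|i]; last by apply/negbTE; apply: contraTneq (ltn_ord i) => ->; rewrite -leqNgt.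
    by rewrite mulr_ge0// addr_ge0 ?expR_ge0.
  rewrite -mulr_suml mulrC EFinM; apply: lee_wpmul2l.
    by rewrite lee_fin invr_ge0 exprn_ge0.
  apply: le_trans (nneseries_lim_ge N _); last by move=> *; exact: nat_ge0.
  by rewrite -(big_mkord xpredT (fun v => (mult g (groot g) v)%:R%R)) sumEFin.
rewrite ge0_muleDr; last 2 first.
- by rewrite lee_fin mulr_ge0// addr_ge0 ?expR_ge0.
- by rewrite mule_ge0 ?root_degree_ge0// lee_fin invr_ge0 exprn_ge0.
rewrite addeC; apply: leeD; last by rewrite EFinM.
by rewrite muleA -EFinM expr2 invfM mulrA mulfV ?mul1r// pnatr_eq0.
Qed.

End Drift.

(** * The operation as a Markov kernel *)

Section Invariance.
Context {R : realType} {b : nat} (lam : R).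
Notation Ch := (choices b.+1).
Context (Pc : probability Ch R).
Hypotheses (indP : independent Pc (@choice_events b.+1))
  (margP : choices_marginals lam Pc id).
Local Open Scope ereal_scope.

Lemma star_nat_preimage (A : set graphs) (g : graphs) (c : Ch) :
  iso_invariant A ->
  (exists2 h, A h & rooted_iso (star g c) h) <-> A (star_nat g c).
Proof.
move=> Ai; split=> [[h Ah ch]|Ac]; last by exists (star_nat g c) => //; exact: star_nat_iso.
apply: (Ai h) => //; apply: rooted_iso_trans (rooted_iso_sym ch) _.
exact: star_nat_iso.
Qed.

Lemma star_law_integral (m : {measure set graphs -> \bar R}) A :
  (m \x Pc) [set w | A (star_nat w.1 w.2)] = \int[m]_g star_law Pc g A.
Proof.
rewrite /product_measure1; apply: eq_integral => g _ /=; rewrite /star_law.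
by congr (Pc _); apply/seteqP; split => c /=; rewrite /xsection/= inE.
Qed.

Lemma measurable_star_law A : measurable A ->
  measurable_fun setT (fun g => star_law Pc g A).
Proof.
move=> mA; have mS := @measurable_star_nat b measurableT _ mA.
have := measurable_fun_xsection Pc mS; congr measurable_fun.
apply/funext => g /=; congr (Pc _); rewrite setTI.
by apply/seteqP; split => c /=; rewrite /xsection/= inE.
Qed.

Section Joint.
Context d (T : measurableType d) (P : probability T R).
Context (nu : probability graphs R) (G : T -> graphs) (C : T -> Ch).
Hypothesis input : star_input P lam nu G C.

Let mG : measurable_fun setT G.
Proof.
case: input => -[mev _] _ _ _ _ _ A mA; rewrite setTI.
by apply: (mev (SGraph _)); exists A.
Qed.

Let mC : measurable_fun setT C.
Proof.
case: input => -[mev _] _ _ _ _; apply: measurable_choices_fun => s A sA.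
case: s sA => [|v i j|u v k|] /=.
- by move=> ->; rewrite preimage_setT.
- by move=> [S _ <-]; apply: (mev (SNewEdges v i j)); exists S.
- by move=> [S _ <-]; apply: (mev (SAttach _ u v k)); exists S.
- by move=> [S _ <-]; apply: (mev (SNewRoot _)); exists S.
Qed.

Let margC : choices_marginals lam P C.
Proof. by case: input => _ _ h1 h2 h3. Qed.

Let joint_rectangle D B : measurable D -> measurable B ->
  P (G @^-1` D `&` C @^-1` B) = nu D * Pc B.
Proof.
move=> mD mB; have [[mev ind] lawG _ _ _] := input.
have mGD : measurable (G @^-1` D) by apply: (mev (SGraph _)); exists D.
rewrite -lawG//.
apply: (choices_law_unique mGD mC _ indP mB) => A l hA ul.
(* [choice_events] allows only the full event at [SGraph], so this position is free for the event of
   the graph. *)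
pose A' s := if s == SGraph _ then G @^-1` D else C @^-1` (A s).
pose l' := SGraph b.+1 :: [seq s <- l | s != SGraph _].
have ul' : uniq l' by rewrite /l' /= mem_filter eqxx/= filter_uniq.
have hA' s : source_events G C s (A' s).
  rewrite /A'; case: eqP => [->|]; first by exists D.
  move: (hA s); case: s => [|v i j|u v k|] //=.
  - by move=> [S _ <-] _; exists S.
  - by move=> [S _ <-] _; exists S.
  - by move=> [S _ <-] _; exists S.
have -> : G @^-1` D `&` \bigcap_(s in [set` l]) (C @^-1` (A s)) =
    \bigcap_(s in [set` l']) A' s.
  apply/seteqP; split => w.
    move=> [Dw h] s /=; rewrite inE mem_filter /A'; case: eqP => //= _ sl.
    exact: h.
  move=> h; split; first by have := h (SGraph _); rewrite /A' eqxx; apply; rewrite /= inE eqxx.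
  move=> s /= sl; have [->|sG] := eqVneq s (SGraph _).
    by have /= -> := hA (SGraph _).
  have := h s; rewrite /A' (negPf sG); apply.
  by rewrite /= inE mem_filter sG sl orbT.
rewrite (independent_seq (phi := id) ind)// /l' big_cons /A' eqxx; congr (_ * _).
rewrite big_filter big_mkcond/=; apply: eq_bigr => s _.
case: eqVneq => [->|sG] /=.
  by have /= -> := hA (SGraph _); rewrite probability_setT.
exact: (choices_marginals_eq mC _ margC margP (hA s)).
Qed.

Lemma joint_law E : measurable E -> P [set w | E (G w, C w)] = (nu \x Pc) E.
Proof.
move=> mE.
have mGC : measurable_fun setT (fun w => (G w, C w)) by exact: measurable_fun_pair.
by rewrite (product_measure_unique (m' := image_measure P mGC)).
Qed.

End Joint.

(** The canonical model, which provides the witness required by [star_invariant]. *)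
Lemma product_star_input (nu : probability graphs R) :
  star_input (nu \x Pc : probability _ R) lam nu fst snd.
Proof.
have margS : choices_marginals lam (nu \x Pc : probability (graphs * Ch)%type R) snd.
  have sndE (B : set Ch) : measurable B -> (nu \x Pc) (snd @^-1` B) = Pc B.
    move=> mB; rewrite (_ : snd @^-1` B = setT `*` B).
      transitivity (nu setT * Pc B); first exact: product_measure1E.
      by rewrite probability_setT mul1e.
    by apply/seteqP; split => -[g c] //= [].
  case: margP => h1 h2 h3; split => [v i j n|u v k ij|i].
  - by rewrite -(h1 v i j n); apply: sndE; exact: measurable_newedges.
  - by rewrite -(h2 u v k ij); apply: sndE; exact: measurable_attach.
  - by rewrite -(h3 i); apply: sndE; exact: measurable_newroot.
pose X (s : source b.+1) (E : set (graphs * Ch)) :=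
  exists D B, [/\ measurable D, choice_events s B, E = D `*` B & s <> SGraph _ -> D = setT].
have evX s E : source_events fst snd s E -> X s E.
  case: s => [|v i j|u v k|] /=.
  - move=> [D mD <-]; exists D, setT; split => //.
    by apply/seteqP; split => -[g c] //= [].
  - move=> [S _ <-]; exists setT, ((fun c => newedges c v i j) @^-1` S);
      split => //; first by exists S.
    by apply/seteqP; split => -[g c] //= [].
  - move=> [S _ <-]; exists setT, ((fun c => attach c u v k) @^-1` S);
      split => //; first by exists S.
    by apply/seteqP; split => -[g c] //= [].
  - move=> [S _ <-]; exists setT, (@newroot b.+1 @^-1` S); split => //; first by exists S.
    by apply/seteqP; split => -[g c] //= [].
split=> [|A mA|||].
- split=> [s E /evX[D [B [mD sB -> _]]]|].
    by apply: measurableX => //; exact: measurable_choice_events sB.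
  move=> n s s_inj E hE.
  have /choice[D /choice[B hDB]] k := evX _ _ (hE k).
  have mD k : measurable (D k) by have [] := hDB k.
  have sB k : choice_events (s k) (B k) by have [] := hDB k.
  have mB k : measurable (B k) := measurable_choice_events (sB k).
  have EE k : E k = D k `*` B k by have [] := hDB k.
  have -> : \bigcap_(k in [set: 'I_n]) E k =
      (\bigcap_(k in [set: 'I_n]) D k) `*` (\bigcap_(k in [set: 'I_n]) B k).
    apply/seteqP; split => -[g c].
      by move=> h; split => k _; have := h k I; rewrite EE => -[].
    by move=> [h1 h2] k _; rewrite EE; split; [exact: h1|exact: h2].
  have mDD : measurable (\bigcap_(k in [set: 'I_n]) D k).
    by apply: fin_bigcap_measurable.
  have mBB : measurable (\bigcap_(k in [set: 'I_n]) B k).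
    by apply: fin_bigcap_measurable.
  transitivity (nu (\bigcap_(k in [set: 'I_n]) D k) *
      Pc (\bigcap_(k in [set: 'I_n]) B k)); first exact: product_measure1E.
  rewrite (indP s_inj sB).
  have -> : nu (\bigcap_(k in [set: 'I_n]) D k) = \prod_(k < n) nu (D k).
    (* An injective family meets [SGraph] at most once, so at most one of the [D k] differs from the
       full event. *)
    have [[k0 sk0]|nk] := pselect (exists k, s k = SGraph _).
      have DT k : k != k0 -> D k = setT.
        move=> kk0; have [_ _ _] := hDB k; apply => sk.
        by move/eqP: kk0; apply; apply: s_inj; rewrite sk sk0.
      rewrite (bigD1 k0)//= big1 ?mule1 => [|k /DT ->]; last exact: probability_setT.
      congr (nu _); apply/seteqP; split => g; first by apply.
      by move=> Dg k _; have [->//|/DT ->] := eqVneq k k0.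
    have DT k : D k = setT.
      by have [_ _ _] := hDB k; apply => sk; apply: nk; exists k.
    rewrite big1 => [|k _]; last by rewrite DT probability_setT.
    by rewrite -(@probability_setT _ _ _ nu); congr (nu _); apply/seteqP; split => // g _ k _; rewrite DT.
  rewrite -big_split/=; apply: eq_bigr => k _.
  by rewrite EE; apply/esym/product_measure1E.
- rewrite (_ : fst @^-1` A = A `*` setT).
    transitivity (nu A * Pc setT); first exact: product_measure1E.
    by rewrite probability_setT mule1.
  by apply/seteqP; split => -[g c] //= [].
- by case: margS.
- by case: margS.
- by case: margS.
Qed.

Lemma star_invariantP (nu : probability graphs R) :
  star_invariant b.+1 lam nu <->
  (forall A, measurable A -> iso_invariant A ->
     \int[nu]_g star_law Pc g A = nu A).
Proof.
split.
  move=> [d [T [P [G [C [input inv]]]]]] A mA Ai.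
  rewrite -star_law_integral -inv//.
  have mS := @measurable_star_nat b measurableT _ mA; rewrite setTI in mS.
  rewrite -(joint_law input mS); congr (P _).
  by apply/seteqP; split => w /=; rewrite star_nat_preimage.
move=> inv; exists _, (graphs * Ch)%type, (nu \x Pc), fst, snd.
split; first exact: product_star_input.
move=> A mA Ai; rewrite -inv// -star_law_integral; congr ((nu \x Pc) _).
by apply/seteqP; split => w /=; rewrite star_nat_preimage.
Qed.

End Invariance.

(** * Uniqueness *)

Section Doeblin.
Context d (T : measurableType d) (R : realType).
Local Open Scope ereal_scope.

(** [p] and [n] are the positive and negative parts of [m - m']. The additive form avoids
    subtraction of extended reals and is symmetric under exchanging the two laws. *)
Lemma probability_jordan (m m' : probability T R) :
  exists (p n : {measure set T -> \bar R}) (A : set T),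
    [/\ measurable A, forall E, measurable E -> m E + n E = m' E + p E,
        n A = 0, p (~` A) = 0 &
        forall E, measurable E -> n E <= m' E /\ p E <= m E].
Proof.
pose eta : {charge set T -> \bar R} := cadd (charge_of_finite_measure m)
  (cscale (-1) (charge_of_finite_measure m')).
have etaE E : eta E = m E - m' E.
  by rewrite /eta/= /cadd/= cscaleN1.
have [A [N hPN]] := Hahn_decomposition eta.
have [[mA _] [mN _] AN AN0] := hPN.
have NA : N = ~` A.
  apply/seteqP; split => x; first by move=> Nx Ax; have : (A `&` N) x by []; rewrite AN0.
  by move=> nAx; have : [set: T] x by []; rewrite -AN => -[].
pose p : {measure set T -> \bar R} := jordan_pos hPN.
pose n : {measure set T -> \bar R} := jordan_neg hPN.
have pE E : measurable E -> p E = m (E `&` A) - m' (E `&` A).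
  by move=> mE; rewrite /p/= jordan_posE cjordan_posE /crestr0 mem_set//; exact: etaE.
have fin (q : probability T R) E : measurable E -> q E \is a fin_num.
  by move=> mE; exact: fin_num_measure.
have nE E : measurable E -> n E = m' (E `&` N) - m (E `&` N).
  move=> mE; rewrite /n/= jordan_negE cjordan_negE /crestr0 mem_set//.
  transitivity (- (m (E `&` N) - m' (E `&` N))); first by congr (- _); exact: etaE.
  by rewrite fin_num_oppeB ?fin//; [rewrite addeC|exact: measurableI].
exists p, n, A; split => //.
- move=> E mE; have mEA := measurableI _ _ mE mA; have mEN := measurableI _ _ mE mN.
  have split q : (q : probability T R) E = q (E `&` A) + q (E `&` N).
    rewrite -measureU//; last by rewrite setIACA AN0 setI0.
    by rewrite -setIUr AN setIT.
  rewrite pE// nE// !split -(fineK (fin m _ mEA)) -(fineK (fin m _ mEN)).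
  rewrite -(fineK (fin m' _ mEA)) -(fineK (fin m' _ mEN)) -!EFinN -!EFinD.
  by congr EFin; ring.
- by rewrite nE// AN0 !measure0 subee.
- by rewrite pE ?setICl ?measure0 ?subee//; exact: measurableC.
- move=> E mE; have mEA := measurableI _ _ mE mA; have mEN := measurableI _ _ mE mN.
  split; [rewrite nE//|rewrite pE//]; rewrite leeBlDr ?fin//.
    apply: le_trans (leeDl _ _) => //; apply: le_measure; rewrite ?inE//.
  apply: le_trans (leeDl _ _) => //; apply: le_measure; rewrite ?inE//.
Qed.

(** Here [f] is the probability of stepping into [A]. Integrating it against [m + n = m' + p] gives
    [m A + \int[n] f = m' A + \int[p] f], which is at most [m' A + p A = m A]; so [f] vanishes
    [n]-almost everywhere. But [f] is nonzero [m']-almost everywhere and [n <= m'], whence [n] is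
    null. *)
Let doeblin_aux (m m' : probability T R) (p n : {measure set T -> \bar R})
    (A : set T) (f : T -> \bar R) :
  measurable A -> (forall E, measurable E -> m E + n E = m' E + p E) ->
  n A = 0 -> p (~` A) = 0 -> (forall E, measurable E -> n E <= m' E) ->
  measurable_fun setT f -> (forall x, 0 <= f x <= 1) ->
  \int[m]_x f x = m A -> \int[m']_x f x = m' A ->
  m' [set x | f x = 0] = 0 -> n setT = 0.
Proof.
move=> mA mn nA pA nm' mf f01 fm fm' f0.
have f_ge0 x : 0 <= f x by have /andP[] := f01 x.
have f_le1 x : f x <= 1 by have /andP[] := f01 x.
have pT : p setT = p A.
  rewrite -(setUv A) measureU//; [|exact: measurableC|by rewrite setICr].
  by apply: etrans (adde0 _); congr (_ + _).
have key : \int[m]_x f x + \int[n]_x f x = \int[m']_x f x + \int[p]_x f x.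
  rewrite -!ge0_integral_measure_add//.
  by apply: eq_measure_integral => E mE _; rewrite [LHS]measure_addE [RHS]measure_addE; exact: mn.
have pf : \int[p]_x f x <= p A.
  rewrite -pT; apply: (@le_trans _ _ (\int[p]_x (cst 1) x)); last by rewrite integral_cst// mul1e.
  by apply: ge0_le_integral.
have mfin E : measurable E -> m E \is a fin_num by move=> mE; exact: fin_num_measure.
have nf0 : \int[n]_x f x = 0.
  apply/eqP; rewrite eq_le integral_ge0 ?andbT; last by [].
  rewrite -(@leeD2lE _ (m A)) ?mfin// adde0 -{1}fm key fm'.
  have -> : m A = m' A + p A by have := mn _ mA; rewrite nA adde0.
  exact: leeD2l.
have nae : {ae n, forall x, setT x -> f x = 0}.
  apply/(ae_eq_integral_abs n measurableT mf).
  by under eq_integral do rewrite gee0_abs//.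
have mf0 : measurable [set x | f x = 0].
  rewrite -[X in measurable X]setTI.
  exact: (mf measurableT [set 0] (emeasurable_set1 0)).
apply/eqP; rewrite eq_le measure_ge0 andbT.
rewrite -(setUv [set x | f x = 0]).
apply: le_trans (measureU2 _ _ _) _ => //; first exact: measurableC.
have n0 : n [set x | f x = 0] <= 0 by apply: le_trans (nm' _ mf0) _; rewrite f0.
have n1 : n (~` [set x | f x = 0]) <= 0.
  suff -> : n (~` [set x | f x = 0]) = 0 by [].
  apply/(negligibleP n (measurableC mf0)).
  apply: negligibleS nae => x /= fx; apply: contra_not fx; exact.
by apply: le_trans (leeD n0 n1) _; rewrite adde0.
Qed.

(* An invariant law is unique as soon as almost every point leads to [t0]: the
   mass of the part of the Hahn decomposition avoiding [t0] must decrease. *)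
Lemma doeblin_unique (m m' : probability T R) (K : set T -> T -> \bar R)
    (t0 : T) :
  (forall A, measurable A -> measurable_fun setT (K A)) ->
  (forall A x, measurable A -> 0 <= K A x <= 1) ->
  (forall A, measurable A -> \int[m]_x K A x = m A) ->
  (forall A, measurable A -> \int[m']_x K A x = m' A) ->
  (forall A, measurable A -> A t0 -> m [set x | K A x = 0] = 0) ->
  (forall A, measurable A -> A t0 -> m' [set x | K A x = 0] = 0) ->
  forall A, measurable A -> m A = m' A.
Proof.
move=> mK K01 Km Km' K0 K0' A0 mA0.
have [p [n [A [mA mn nA pA nm]]]] := probability_jordan m m'.
have mAC := measurableC mA.
have pnT : n setT = p setT.
  have := mn _ (@measurableT _ T); rewrite !probability_setT.
  by move=> /(congr1 (fun x => x - 1)); rewrite ![1 + _]addeC !addeK.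
have nT : n setT = 0.
  have [At0|At0] := pselect (A t0).
    apply: (doeblin_aux mA mn nA pA _ (mK _ mA)) => //.
    - by move=> E /nm[].
    - by move=> x; exact: K01.
    - exact: Km.
    - exact: Km'.
    - exact: K0'.
  (* Now [t0] lies in the complement of [A], and the same argument applies with the two laws and the
     two parts exchanged. *)
  rewrite pnT; apply: (doeblin_aux (m := m') (m' := m) mAC _ pA _ _ (mK _ mAC)) => //.
  - by move=> E mE; exact/esym/mn.
  - by rewrite setCK.
  - by move=> E /nm[].
  - by move=> x; exact: K01.
  - exact: Km'.
  - exact: Km.
  - exact: K0.
have z (q : {measure set T -> \bar R}) : q setT = 0 -> q A0 = 0.
  move=> qT; apply/eqP; rewrite eq_le measure_ge0 andbT -qT.
  by apply: le_measure; rewrite ?inE.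
by have := mn _ mA0; rewrite (z n nT) (z p) ?adde0// -pnT.
Qed.

End Doeblin.

(* The same graphs, with the coarser sigma-algebra of [same_law]. *)
Definition unlabelled : Type := rmgraph nat.

HB.instance Definition _ := gen_eqMixin unlabelled.
HB.instance Definition _ := gen_choiceMixin unlabelled.
HB.instance Definition _ := isPointed.Build unlabelled rmgraph_point.

Definition invariant_events : set (set unlabelled) :=
  [set A | measurable (A : set graphs) /\ iso_invariant A].

Fact invariant_events0 : invariant_events set0.
Proof. by split; [exact: measurable0|]. Qed.

Fact invariant_eventsC A : invariant_events A -> invariant_events (~` A).
Proof. by move=> [mA Ai]; split; [exact: measurableC|exact: iso_invariantC]. Qed.

Fact invariant_events_bigcup (F : (set unlabelled)^nat) :
  (forall i, invariant_events (F i)) -> invariant_events (\bigcup_i F i).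
Proof.
move=> hF; split; first by apply: (@bigcupT_measurable _ graphs) => i; have [] := hF i.
by move=> g h gh [i _ Fg]; exists i => //; have [_ Fi] := hF i; exact: Fi gh Fg.
Qed.

HB.instance Definition _ := @isMeasurable.Build (sigma_display invariant_events)
  unlabelled invariant_events invariant_events0 invariant_eventsC
  invariant_events_bigcup.

Definition forget (g : graphs) : unlabelled := g.

Lemma measurable_forget : measurable_fun setT forget.
Proof. by move=> _ A [mA _]; rewrite setTI. Qed.

Definition image_probability d d' (T1 : measurableType d)
    (T2 : measurableType d') (R : realType) (m : probability T1 R)
    (f : T1 -> T2) (mf : measurable_fun setT f) : probability T2 R :=
  HB.pack (image_measure m mf : set T2 -> \bar R)
    (Measure.class (image_measure m mf))
    (Measure_isProbability.Build _ _ _ (image_measure m mf)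
      (@probability_setT _ _ _ m)).

Section Uniqueness.
Context {R : realType} {b : nat} (hb : (0 < b)%N) (lam : R) (hlam : (0 < lam)%R).
Notation Ch := (choices b.+1).
Context (Pc : probability Ch R).
Hypotheses (indP : independent Pc (@choice_events b.+1))
  (margP : choices_marginals lam Pc id).
Local Open Scope ereal_scope.

Lemma rmgraph_point_isolated : isolated rmgraph_point.
Proof. by []. Qed.

Lemma rmgraph_point_connected : gconnected rmgraph_point.
Proof. by move=> u v /= -> ->; exists [::]. Qed.

Lemma isolated_star_nat (A : set graphs) g (c : Ch) : iso_invariant A ->
  isolated (star_nat g c) -> A (star_nat g c) <-> A rmgraph_point.
Proof.
move=> Ai ci.
have iso : rooted_iso (star_nat g c) rmgraph_point.
  apply: isolated_iso => //; first exact: star_nat_connected.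
  exact: rmgraph_point_connected.
by split; [exact: Ai|exact/Ai/rooted_iso_sym].
Qed.

Lemma star_law_isolated_gt0 g : root_degree R g \is a fin_num ->
  0 < star_law Pc g isolated.
Proof.
move=> gfin; have [theta /andP[t0 _] ht] := isolation_lower hb hlam indP margP.
have [M gM] : exists M : nat, root_degree R g <= (M%:R)%:E.
  exists (Num.truncn (fine (root_degree R g))).+1.
  rewrite -(fineK gfin) lee_fin ltW//.
  by have /andP[] := truncn_itv (fine_ge0 (root_degree_ge0 (R := R) g)).
by apply: lt_le_trans (ht g M gM); rewrite lte_fin exprn_gt0.
Qed.

Lemma star_fixed_unique (nu nu' : probability graphs R) :
  star_fixed b.+1 lam nu -> star_fixed b.+1 lam nu' -> same_law nu nu'.
Proof.
move=> hnu hnu'.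
pose F (m : probability graphs R) := image_probability m measurable_forget.
(* Finite expected root degree enters here: the degree is finite almost everywhere, so the
   one-vertex graph is reached with positive probability. *)
have null (m : probability graphs R) A : star_fixed b.+1 lam m ->
    measurable (A : set unlabelled) -> A rmgraph_point ->
    F m [set g | star_law Pc g A = 0] = 0.
  move=> [_ deg _] [mA Ai] Apt.
  have int : m.-integrable setT (root_degree R).
    apply/integrableP; split; first exact: measurable_root_degree.
    apply: le_lt_trans deg; apply: ge0_le_integral => //.
    - by apply: measurableT_comp => //; exact: measurable_root_degree.
    - exact: measurable_root_degree.
    - by move=> g _; rewrite gee0_abs//; exact: root_degree_ge0.
  have mz : measurable [set g : graphs | star_law Pc g A = 0].
    rewrite -[X in measurable X]setTI.
    exact: (measurable_star_law Pc mA measurableT (emeasurable_set1 0)).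
  apply/(negligibleP m mz); apply: negligibleS (integrable_ae measurableT int).
  move=> g /= g0 /(_ I) gfin; have := star_law_isolated_gt0 gfin.
  rewrite ltNge; apply/negP; rewrite negbK -g0; apply: le_measure; rewrite ?inE.
  - exact: measurable_star_nat_r measurable_isolated.
  - exact: measurable_star_nat_r.
  - by move=> c /= ci; apply/(isolated_star_nat Ai ci).
(* [star_law_iso] makes the kernel measurable for the coarser sigma-algebra, so the chain descends
   to isomorphism classes. *)
have mlaw A : measurable (A : set unlabelled) ->
    measurable_fun [set: unlabelled] (fun g => star_law Pc g A).
  move=> [mA Ai] _ S mS; rewrite setTI; split.
    by rewrite -[X in measurable X]setTI; exact: (measurable_star_law Pc mA).
  by move=> g h gh /=; rewrite (star_law_iso indP margP gh).
have inv (m : probability graphs R) A : star_fixed b.+1 lam m ->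
    measurable (A : set unlabelled) -> \int[F m]_g star_law Pc g A = F m A.
  move=> [_ _ /(star_invariantP indP margP) minv] mA; have [mA' Ai] := mA.
  transitivity (\int[m]_g star_law Pc g A); last exact: minv.
  by rewrite [LHS](ge0_integral_pushforward measurable_forget m measurableT (mlaw _ mA))//.
move=> A mA Ai.
apply: (@doeblin_unique _ unlabelled R (F nu) (F nu') (fun A g => star_law Pc g A)
  rmgraph_point) => //.
- move=> B g [mB Bi]; rewrite measure_ge0 probability_le1//.
  exact: measurable_star_nat_r.
- by move=> B; exact: inv.
- by move=> B; exact: inv.
- by move=> B; exact: null.
- by move=> B; exact: null.
Qed.

End Uniqueness.

(** * Existence *)

(** [a n] is the mass surviving at time [n], [z n] the mass returning in the next step, and [D n]
    the total root degree of the surviving mass. Summing the drift gives [\sum D <= c * \sum a].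
    Since the returns sum to at most 1, [low] yields [eps * \sum a <= 1 + eps / M * c * \sum a]. *)
Lemma lyapunov_sums (R : realType) (a D z : nat -> R) (beta k : R) :
  (forall n, 0 <= a n) -> (forall n, 0 <= D n) ->
  a 0%N = 1 -> D 0%N = 0 -> (forall n, a n = z n + a n.+1) ->
  0 <= beta < 1 -> 0 <= k -> (forall n, D n.+1 <= beta * D n + k * a n) ->
  (forall M : nat, (0 < M)%N -> exists2 eps, 0 < eps &
     forall n, eps * a n <= z n + eps / M%:R * D n) ->
  exists L : R, forall N, \sum_(n < N) a n <= L /\ \sum_(n < N) D n <= L.
Proof.
move=> a0 D0 a1 D1 az /andP[b0 b1] k0 drift low.
pose c := k / (1 - beta).
have c0 : 0 <= c by rewrite divr_ge0// subr_ge0 ltW.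
(* With [c / M < 1 / 2], half of the left side absorbs the degree term, which leaves
   [\sum a <= 2 / eps]. *)
pose M := (Num.truncn (2 * c)).+1.
have cM : 2 * c < M%:R by have /andP[] := truncn_itv (mulr_ge0 (ler0n R 2) c0).
have M0 : 0 < M%:R :> R by [].
have [eps e0 he] := low M isT.
have sumD N : \sum_(n < N) D n <= c * \sum_(n < N) a n.
  have h : \sum_(n < N) D n <= beta * \sum_(n < N) D n + k * \sum_(n < N) a n.
    apply: (@le_trans _ _ (\sum_(n < N.+1) D n)).
      by rewrite big_ord_recr/= lerDl.
    rewrite big_ord_recl D1 add0r !mulr_sumr -big_split/=.
    by apply: ler_sum => n _; exact: drift.
  rewrite /c mulrAC ler_pdivlMr ?subr_gt0//.
  by rewrite mulrBr mulr1 lerBlDl (mulrC _ beta).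
have sumz N : \sum_(n < N) z n = 1 - a N.
  elim: N => [|N IH]; first by rewrite big_ord0 a1 subrr.
  by rewrite big_ord_recr/= IH (az N); ring.
have suma N : \sum_(n < N) a n <= 2 / eps.
  have h1 : eps * \sum_(n < N) a n <= 1 + eps / M%:R * (c * \sum_(n < N) a n).
    apply: (@le_trans _ _ (\sum_(n < N) z n + eps / M%:R * \sum_(n < N) D n)).
      by rewrite !mulr_sumr -big_split/=; apply: ler_sum => n _; exact: he.
    apply: lerD; first by rewrite sumz gerBl.
    by apply: ler_wpM2l; [rewrite divr_ge0// ltW|exact: sumD].
  have S0 : 0 <= \sum_(n < N) a n by exact: sumr_ge0.
  have h2 : eps / M%:R * (c * \sum_(n < N) a n) <= eps / 2 * \sum_(n < N) a n.
    rewrite mulrA ler_wpM2r// -!mulrA ler_wpM2l ?(ltW e0)//.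
    by rewrite mulrC ler_pdivrMr// ler_pdivlMl// ltW.
  rewrite ler_pdivlMr//.
  move: (le_trans h1 (lerD (lexx 1) h2)); set S := \sum_(n < N) a n; nra.
exists (Num.max (2 / eps) (c * (2 / eps))) => N; split; rewrite le_max.
  by rewrite suma.
by apply/orP; right; apply: le_trans (sumD N) _; rewrite ler_wpM2l.
Qed.

Section Restriction.
Context d (T : measurableType d) (R : realType).
Local Open Scope ereal_scope.

Lemma ge0_integral_mrestr_le (m : {measure set T -> \bar R}) (D : set T)
    (mD : measurable D) (f : T -> \bar R) :
  measurable_fun setT f -> (forall x, 0 <= f x) ->
  \int[mrestr m mD]_x f x <= \int[m]_x f x.
Proof.
move=> mf f0; have mDC := measurableC mD.
have -> : \int[m]_x f x = \int[measure_add (mrestr m mD) (mrestr m mDC)]_x f x.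
  apply: eq_measure_integral => E mE _; rewrite [RHS]measure_addE.
  change (m E = m (E `&` D) + m (E `&` ~` D)).
  by rewrite -measureU//; [rewrite -setIUr setUv setIT|exact: measurableI
    |exact: measurableI|rewrite setIACA setICr setI0].
by rewrite ge0_integral_measure_add// leeDl// integral_ge0.
Qed.

End Restriction.

Section Existence.
Context {R : realType} {b : nat} (hb : (0 < b)%N) (lam : R) (hlam : (0 < lam)%R).
Notation Ch := (choices b.+1).
Context (Pc : probability Ch R).
Hypotheses (indP : independent Pc (@choice_events b.+1))
  (margP : choices_marginals lam Pc id).
Local Open Scope ereal_scope.

Section Step.
Variable m : {finite_measure set graphs -> \bar R}.

(* One step of the chain, killed upon reaching a graph with an isolated root; the
   sum of its iterates is the occupation measure of an excursion. *)
Definition killed_step : {measure set graphs -> \bar R} :=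
  mrestr (image_measure (m \x Pc) (@measurable_star_nat b))
    (measurableC measurable_isolated).

Lemma killed_stepE A :
  killed_step A = \int[m]_g star_law Pc g (A `\` isolated).
Proof. by rewrite -star_law_integral. Qed.

Lemma star_law_le1 g A : measurable A -> 0 <= star_law Pc g A <= 1.
Proof.
move=> mA; rewrite measure_ge0 probability_le1//.
exact: measurable_star_nat_r.
Qed.

Lemma killed_step_finite : fin_num_fun killed_step.
Proof.
move=> A mA; rewrite killed_stepE.
have mAI : measurable (A `\` isolated) by apply: measurableD => //; exact: measurable_isolated.
rewrite ge0_fin_numE; last by apply: integral_ge0 => g _; have /andP[] := star_law_le1 g mAI.
apply: (@le_lt_trans _ _ (\int[m]_g cst 1 g)).
  apply: ge0_le_integral => //.
  - exact: measurable_star_law.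
  - by move=> g _; have /andP[] := star_law_le1 g mAI.
by rewrite integral_cst// mul1e ltey_eq fin_num_measure.
Qed.

Definition killed_step_fin : {finite_measure set graphs -> \bar R} :=
  HB.pack (killed_step : set graphs -> \bar R) (Measure.class killed_step)
    (Measure_isFinite.Build _ _ _ killed_step killed_step_finite).

Lemma killed_step_integral_le (f : graphs -> \bar R) :
  measurable_fun setT f -> (forall g, 0 <= f g) ->
  \int[killed_step]_g f g <= \int[m]_g \int[Pc]_c f (star_nat g c).
Proof.
move=> mf f0; apply: le_trans (ge0_integral_mrestr_le _ _ mf f0) _.
rewrite (ge0_integral_pushforward (@measurable_star_nat b))//.
rewrite preimage_setT (fubini_tonelli1 (m1 := m) (m2 := Pc))//.
  exact: (measurableT_comp mf (@measurable_star_nat b)).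
by move=> w; exact: f0.
Qed.

End Step.

(** The law at time [n] of the chain started from the one-vertex graph, on the event that it has not
    returned during the first [n] steps; its total mass is the tail of the return time. *)
Fixpoint killed_iter (n : nat) : {finite_measure set graphs -> \bar R} :=
  if n is n'.+1 then killed_step_fin (killed_iter n') else \d_rmgraph_point.

Let q := killed_iter.
Let Q : {measure set graphs -> \bar R} := mseries q 0.

(** A full step either survives or returns. All returning graphs are isomorphic to [rmgraph_point],
    so an invariant event contains all of them or none. *)
Let q_law_split n A : measurable A -> iso_invariant A ->
  \int[q n]_g star_law Pc g A =
  q n.+1 A + \d_rmgraph_point A * \int[q n]_g star_law Pc g isolated.
Proof.
move=> mA Ai; have mI := measurable_isolated.
have mAI := measurableI _ _ mA mI; have mAD := measurableD mA mI.
have ge0 B g : 0 <= star_law Pc g B by exact: measure_ge0.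
rewrite [q n.+1 A]killed_stepE.
transitivity (\int[q n]_g (star_law Pc g (A `\` isolated) + star_law Pc g (A `&` isolated))).
  apply: eq_integral => g _; rewrite /star_law -measureU.
  - by congr (Pc _); rewrite -[in LHS](setIT A) -(setvU isolated) setIUr.
  - exact: measurable_star_nat_r mAD.
  - exact: measurable_star_nat_r mAI.
  - by apply/seteqP; split => // c [[_ nI] [_]].
rewrite ge0_integralD//; try exact: measurable_star_law.
congr (_ + _); rewrite -ge0_integralZl//; last first.
- exact: measurable_star_law.
apply: eq_integral => g _; rewrite diracE /star_law.
case: (boolP (rmgraph_point \in A)) => [/set_mem pA|/negP nA].
  rewrite mul1e; congr (Pc _); apply/seteqP; split => c; first by case.
  by move=> ci; split => //; exact/(isolated_star_nat Ai ci).
rewrite mul0e (_ : [set c | _] = set0) ?measure0//.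
apply/seteqP; split => // c [Ac ci]; apply: nA; apply/mem_set.
exact/(isolated_star_nat Ai ci).
Qed.

Let mass_fin n : q n setT \is a fin_num.
Proof. exact: fin_num_measure. Qed.

Let star_law_isolated01 g : 0 <= star_law Pc g isolated <= 1.
Proof. exact: star_law_le1 measurable_isolated. Qed.

Let mlaw_isolated : measurable_fun setT (fun g => star_law Pc g isolated).
Proof. exact: measurable_star_law measurable_isolated. Qed.

Let return_fin n : \int[q n]_g star_law Pc g isolated \is a fin_num.
Proof.
rewrite ge0_fin_numE; last by apply: integral_ge0 => g _; have /andP[] := star_law_isolated01 g.
apply: (@le_lt_trans _ _ (\int[q n]_g cst 1 g)).
  apply: ge0_le_integral => //.
  by move=> g _; have /andP[] := star_law_isolated01 g.
by rewrite integral_cst// mul1e ltey_eq mass_fin.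
Qed.

Let mass_split n : q n setT = \int[q n]_g star_law Pc g isolated + q n.+1 setT.
Proof.
have := @q_law_split n setT measurableT (fun _ _ _ _ => I).
rewrite diracT mul1e addeC => <-.
rewrite -[LHS]mul1e -(integral_cst (q n) measurableT).
apply: eq_integral => g _; rewrite /star_law -(@probability_setT _ _ _ Pc).
by congr (Pc _); apply/seteqP; split.
Qed.

Let drift_const : exists2 k : R, (0 <= k)%R & forall g,
  \int[Pc]_c root_degree R (star_nat g c) <=
  (b.+1%:R^-1)%:E * root_degree R g + k%:E.
Proof.
eexists; last by move=> g; exact: (star_degree_drift hlam indP margP).
by rewrite !mulr_ge0// addr_ge0// expR_ge0.
Qed.

Let Dq n : \bar R := \int[q n]_g root_degree R g.

Let Dq_ge0 n : 0 <= Dq n.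
Proof. by apply: integral_ge0 => g _; exact: root_degree_ge0. Qed.

Let Dq_drift (k : R) : (0 <= k)%R -> (forall g,
    \int[Pc]_c root_degree R (star_nat g c) <=
    (b.+1%:R^-1)%:E * root_degree R g + k%:E) ->
  forall n, Dq n.+1 <= (b.+1%:R^-1)%:E * Dq n + k%:E * q n setT.
Proof.
move=> k0 hk n; have md := @measurable_root_degree R.
have B0 : 0 <= (b.+1%:R^-1 : R)%:E by rewrite lee_fin invr_ge0.
apply: le_trans (killed_step_integral_le (q n) md (root_degree_ge0 (R := R))) _.
have mBd : measurable_fun setT (fun g => (b.+1%:R^-1)%:E * root_degree R g).
  exact: measurable_funeM.
have Bd0 g : 0 <= (b.+1%:R^-1)%:E * root_degree R g.
  by rewrite mule_ge0// root_degree_ge0.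
apply: (@le_trans _ _ (\int[q n]_g ((b.+1%:R^-1)%:E * root_degree R g + k%:E))).
  apply: ge0_le_integral => //.
  - by move=> g _; apply: integral_ge0 => c _; exact: root_degree_ge0.
  - apply: (measurable_fun_fubini_tonelli_F (m2 := Pc)
      (fun w : graphs * Ch => root_degree R (star_nat w.1 w.2))).
      exact: (measurableT_comp md (@measurable_star_nat b)).
    by move=> w; exact: root_degree_ge0.
  - exact: emeasurable_funD.
rewrite ge0_integralD// ge0_integralZl//; last by move=> g _; exact: root_degree_ge0.
by rewrite (integral_cst (q n) measurableT k%:E).
Qed.

Lemma killed_iter_bound : exists2 L : R, (0 < L)%R &
  forall N, \sum_(0 <= n < N) q n setT <= L%:E /\
    \sum_(0 <= n < N) \int[q n]_g root_degree R g <= L%:E.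
Proof.
have [k k0 hk] := drift_const; have drift := Dq_drift k0 hk.
have q0 : q 0 setT = 1 by exact: probability_setT.
have D0 : Dq 0 = 0.
  rewrite /Dq integral_dirac//; last exact: measurable_root_degree.
  by rewrite diracT mul1e; exact: root_degree0 rmgraph_point_isolated.
have Dfin n : Dq n \is a fin_num.
  elim: n => [|n IH]; first by rewrite D0.
  rewrite ge0_fin_numE//; apply: le_lt_trans (drift n) _.
  by rewrite -(fineK IH) -(fineK (mass_fin n)) -!EFinM -EFinD ltry.
have [theta /andP[t0 t1] htheta] := isolation_lower hb hlam indP margP.
have [L hL] : exists L : R, forall N,
    (\sum_(n < N) fine (q n setT) <= L)%R /\ (\sum_(n < N) fine (Dq n) <= L)%R.
  apply: (@lyapunov_sums R (fun n => fine (q n setT)) (fun n => fine (Dq n))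
    (fun n => fine (\int[q n]_g star_law Pc g isolated))
    (b.+1%:R^-1)%R k) => //.
  - by move=> n; exact: fine_ge0.
  - by move=> n; exact: fine_ge0.
  - exact: (congr1 fine q0).
  - exact: (congr1 fine D0).
  - by move=> n; rewrite -fineD//; congr fine; exact: mass_split.
  - by rewrite invr_ge0 ler0n/= invf_lt1// ltr1n ltnS.
  - move=> n; rewrite -lee_fin EFinD !EFinM !fineK//.
  - move=> M M0; pose eps := (theta ^+ (b.+2 + M))%R.
    have e0 : (0 < eps)%R by rewrite exprn_gt0.
    exists eps => // n; rewrite -lee_fin EFinD !EFinM !fineK//.
    have M0' : (0 < M%:R :> R)%R by rewrite ltr0n.
    have eM : 0 <= (eps / M%:R)%:E by rewrite lee_fin divr_ge0// ltW.
    rewrite -(integral_cst (q n) measurableT eps%:E).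
    rewrite -ge0_integralZl//; last 2 first.
    + exact: measurable_root_degree.
    + by move=> g _; exact: root_degree_ge0.
    have mZ : measurable_fun setT (fun g => (eps / M%:R)%:E * root_degree R g).
      by apply: measurable_funeM; exact: measurable_root_degree.
    have Z0 g : 0 <= (eps / M%:R)%:E * root_degree R g.
      by rewrite mule_ge0// root_degree_ge0.
    have S0 g : 0 <= star_law Pc g isolated by have /andP[] := star_law_isolated01 g.
    rewrite -ge0_integralD//; apply: ge0_le_integral => //.
    + by move=> g _; rewrite lee_fin ltW.
    + exact: emeasurable_funD.
    (* Pointwise, [eps] is bounded by the isolation probability when the degree is at most [M], and
       by [eps / M] times the degree otherwise. *)
    move=> g _ /=; have [dM|Md] := leP (root_degree R g) (M%:R)%:E.
      by apply: le_trans (htheta g M dM) _; rewrite leeDl.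
    rewrite -[leLHS]add0e; apply: leeD => //.
    apply: (@le_trans _ _ ((eps / M%:R)%:E * (M%:R)%:E)).
      by rewrite -EFinM divfK ?gt_eqF.
    by apply: lee_wpmul2l => //; exact: ltW.
exists (Num.max L 1%R); first by rewrite lt_max ltr01 orbT.
move=> N; have [h1 h2] := hL N; split.
  rewrite big_mkord (eq_bigr (fun n : 'I_N => (fine (q n setT))%:E)) => [|n _].
    by rewrite sumEFin lee_fin le_max h1.
  by rewrite fineK.
rewrite big_mkord (eq_bigr (fun n : 'I_N => (fine (Dq n))%:E)) => [|n _].
  by rewrite sumEFin lee_fin le_max h2.
by rewrite fineK.
Qed.

(** The partial sums telescope to 1 minus the surviving mass, which tends to 0 because its series is
    bounded: the chain returns almost surely. *)
Lemma killed_iter_return :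
  \sum_(0 <= n <oo) \int[q n]_g star_law Pc g isolated = 1.
Proof.
have [L L0 hL] := killed_iter_bound.
have a0 n : (0 <= fine (q n setT))%R by exact: fine_ge0.
have acvg : (fine (q n setT))%R @[n --> \oo] --> (0 : R)%R.
  apply: cvg_series_cvg_0; apply: nondecreasing_is_cvgn.
    by apply/nondecreasing_seqP => n; rewrite /series/= big_nat_recr//= lerDl.
  exists L => _ [N _ <-]; have [+ _] := hL N.
  rewrite /series/= (eq_bigr (fun n => (fine (q n setT))%:E)) => [|n _]; last by rewrite fineK.
  by rewrite sumEFin lee_fin.
have sumz N : \sum_(0 <= n < N) \int[q n]_g star_law Pc g isolated =
    (1 - fine (q N setT))%:E.
  elim: N => [|N IH].
    by rewrite big_nil [q 0 _]probability_setT/= subrr.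
  rewrite big_nat_recr//= IH -(fineK (return_fin N)) -EFinD; congr EFin.
  have := congr1 fine (mass_split N); rewrite fineD// => ->; ring.
apply/cvg_lim => //; under eq_fun do rewrite sumz.
apply: cvg_EFin; first exact: nearW.
rewrite -[X in _ --> X](subr0 (1 : R))%R.
by apply: cvgB; [exact: cvg_cst|exact: acvg].
Qed.

Lemma killed_iter_disconnected n : q n (~` [set g | gconnected g]) = 0.
Proof.
have mC := measurableC measurable_gconnected.
case: n => [|n].
  by rewrite /= diracE memNset//= => nc; apply: nc; exact: rmgraph_point_connected.
rewrite [LHS]killed_stepE integral0_eq// => g _.
rewrite /star_law (_ : [set c | _] = set0) ?measure0//.
by apply/seteqP; split => // c [nc _]; apply: nc; exact: star_nat_connected.
Qed.

Lemma star_fixed_exists : exists mu : probability graphs R, star_fixed b.+1 lam mu.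
Proof.
have [L L0 hL] := killed_iter_bound.
have QE A : Q A = \sum_(0 <= n <oo) q n A by [].
have QL : Q setT <= L%:E.
  rewrite QE; apply: lime_le; first by apply: is_cvg_nneseries.
  by apply: nearW => N; have [] := hL N.
have Q1 : 1 <= Q setT.
  rewrite QE; apply: le_trans (nneseries_lim_ge 1 _) => //.
  by rewrite big_nat1 [q 0 _]probability_setT.
have Qfin : Q setT \is a fin_num.
  by rewrite ge0_fin_numE//; exact: le_lt_trans QL (ltry _).
pose Z := fine (Q setT).
have ZE : Z%:E = Q setT by rewrite fineK.
have Z0 : (0 < Z)%R by rewrite -lte_fin ZE; exact: lt_le_trans Q1.
have Zi0 : (0 <= Z^-1)%R by rewrite invr_ge0 ltW.
pose m : {measure set graphs -> \bar R} := mscale (NngNum Zi0) Q.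
have mE A : m A = Z^-1%:E * Q A by [].
have mT : m setT = 1 by rewrite mE -ZE -EFinM mulVf ?gt_eqF.
pose mu : probability graphs R := HB.pack (m : set graphs -> \bar R)
  (Measure.class m) (Measure_isProbability.Build _ _ _ m mT).
have int f : measurable_fun setT f -> (forall g, 0 <= f g) ->
    \int[mu]_g f g = Z^-1%:E * \sum_(0 <= n <oo) \int[q n]_g f g.
  move=> mf f0.
  transitivity (\int[m]_g f g); first by apply: eq_measure_integral.
  by rewrite ge0_integral_mscale// ge0_integral_measure_series.
exists mu; split.
- exists (~` [set g | gconnected g]); split => //.
    exact: (measurableC measurable_gconnected).
  rewrite [LHS]mE QE eseries0 ?mule0// => n _ _.
  exact: killed_iter_disconnected.
- rewrite /expected_root_degree (int (root_degree R)); last 2 first.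
  + exact: measurable_root_degree.
  + exact: root_degree_ge0.
  apply: (@le_lt_trans _ _ (Z^-1%:E * L%:E)); last by rewrite -EFinM ltry.
  apply: lee_wpmul2l; first by rewrite lee_fin.
  apply: lime_le.
    by apply: is_cvg_nneseries => n _ _; apply: integral_ge0 => g _; exact: root_degree_ge0.
  by apply: nearW => N; have [] := hL N.
- apply/(star_invariantP indP margP) => A mA Ai.
  rewrite int; last 2 first.
  + exact: measurable_star_law.
  + by move=> g; exact: measure_ge0.
  rewrite [RHS]mE QE; congr (_ * _).
  transitivity (\sum_(0 <= n <oo) (q n.+1 A +
      \d_rmgraph_point A * \int[q n]_g star_law Pc g isolated)).
    by apply: eq_eseriesr => n _; exact: q_law_split.
  rewrite nneseriesD; last 2 first.
  + by [].
  + by move=> n _ _; rewrite mule_ge0// integral_ge0// => g _; exact: measure_ge0.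
  have -> : \sum_(0 <= n <oo) \d_rmgraph_point A * \int[q n]_g star_law Pc g isolated =
      \d_rmgraph_point A.
    rewrite diracE nneseriesZl; last by move=> n _; apply: integral_ge0 => g _; exact: measure_ge0.
    by rewrite killed_iter_return mule1.
  (* One step shifts the series by one index; the returned mass, a Dirac mass of weight 1, restores
     the missing term [q 0]. *)
  rewrite [RHS](nneseries_split 0 1)// big_nat1 [RHS]addeC; congr (_ + _).
  rewrite -(@nneseries_addn _ (fun n => q n A) 1)//.
  by apply: eq_eseriesr => n _; rewrite addn1.
Qed.

End Existence.

Theorem proposition1p1 (R : realType) (b : nat) (hb : (2 <= b)%N)
    (lam : R) (hlam : 0 < lam) :
  exists mu : probability (rmgraph nat) R,
    star_fixed b lam mu /\
    forall nu : probability (rmgraph nat) R,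
      star_fixed b lam nu -> same_law mu nu.
Proof.
case: b hb => // b hb.
have [Pc [indP margP]] := choices_law_exists (b := b) hlam.
have [mu hmu] := star_fixed_exists hb hlam indP margP.
exists mu; split => // nu hnu.
exact: (star_fixed_unique hb hlam indP margP hmu hnu).
Qed.
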